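(* Let $p\in[2,3)$, let $\mathbf{X}=(X,\mathbb{X})$ be a càdlàg $p$-rough path over $\mathbb{R}^d$ on $[0,T]$ and let $(Y,Y')$ be a controlled rough path with respect to $X$. For finite partitions $\mathcal{P}$ of $[0,T]$ put $$S(\mathcal P)=\sum_{[s,t]\in\mathcal P}\big(Y_{s-}X_{s,t}+Y'_{s-}\tilde{\mathbb X}_{s,t}\big),\qquad S'(\mathcal P)=\sum_{[s,t]\in\mathcal P}\big(Y_{s}X_{s,t}+Y'_{s}\mathbb X_{s,t}\big),$$ where $\tilde{\mathbb X}_{s,t}=\mathbb X_{s,t}+\Delta_sX\otimes X_{s,t}$. Then the limits $\lim_{|\mathcal P|\to0}S(\mathcal P)$ and $\lim_{|\mathcal P|\to0}S'(\mathcal P)$ both exist in the Refinement Riemann--Stieltjes (RRS) sense and are equal; their common value is denoted $\int_0^TY_{r-}\,d\mathbf X_r$. Furthermore, there exists a constant $C$ depending only on $p$ such that for all $0\le s\le t\le T$ $$\Big|\int_s^tY_{r-}d\mathbf X_r-Y_{s-}X_{s,t}-Y'_{s-}\tilde{\mathbb X}_{s,t}\Big|\le C\Big(\|\tilde R\|_{\frac p2,[s,t]}\|X\|_{p,[s,t]}+\|Y'^{-}\|_{p,[s,t]}\|\tilde{\mathbb X}\|_{\frac p2,[s,t]}\Big),$$ $$\Big|\int_s^tY_{r-}d\mathbf X_r-Y_{s}X_{s,t}-Y'_{s}\mathbb X_{s,t}\Big|\le C\Big(\|R\|_{\frac p2,[s,t]}\|X\|_{p,[s,t]}+\|Y'\|_{p,[s,t]}\|\mathbb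 X\|_{\frac p2,[s,t]}\Big).$$
   Context: For a path $Z$ write $Z_{s,t}=Z_t-Z_s$, $Z^-_t=Z_{t-}=\lim_{s\uparrow t}Z_s$, with convention $Z_{0-}=Z_0$, and $\Delta_tZ=Z_t-Z_{t-}$. For one- or two-parameter functions, $\|Z\|_{q,[s,t]}=(\sup_{\mathcal P}\sum_{[u,v]\in\mathcal P}|Z_{u,v}|^q)^{1/q}$, supremum over finite partitions of $[s,t]$. A càdlàg $p$-rough path $\mathbf X=(X,\mathbb X)$ consists of $X:[0,T]\to\mathbb{R}^d$ and $\mathbb X:\{0\le s\le t\le T\}\to\mathbb{R}^{d\times d}$ such that: (i) $\mathbb X_{s,t}-\mathbb X_{s,u}-\mathbb X_{u,t}=X_{s,u}\otimes X_{u,t}$ for $s\le u\le t$ (Chen's relation); (ii) $t\mapsto(X_{0,t},\mathbb X_{0,t})$ is càdlàg; (iii) $\|X\|_{p,[0,T]}+\|\mathbb X\|_{p/2,[0,T]}^{1/2}<\infty$. A controlled rough path is a pair $(Y,Y')$ of càdlàg paths of finite $p$-variation, $Y$ with values in $L(\mathbb{R}^d,E)$ ($E$ a finite-dimensional normed space) and $Y'$ with values in $L(\mathbb{R}^d,L(\mathbb{R}^d,E))\cong L(\mathbb{R}^d\otimes\mathbb{R}^d,E)$, such that $R_{s,t}:=Y_{s,t}-Y'_sX_{s,t}$ has finite $p/2$-variation. Set $\tilde R_{s,t}:=Y^-_{s,t}-Y'_{s-}X^-_{s,t}$. RRS convergence: $\lim_{|\mathcal P|\to0}S(\mathcal P)=L$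 in (RRS) sense means that for every $\varepsilon>0$ there is a partition $\mathcal P_0$ such that $|S(\mathcal P)-L|<\varepsilon$ for every partition $\mathcal P\supset\mathcal P_0$. The integral $\int_s^t$ is defined in the same way over partitions of $[s,t]$ (with $Y_{s-},Y'_{s-},\Delta_sX$ those of the paths on $[0,T]$). *)

(* Defs.v *)
(* MathComp-Analysis: real analysis over an arbitrary [R : realType]. *)
From HB Require Import structures.
From mathcomp Require Import all_boot all_order all_algebra.
From mathcomp Require Import all_classical all_reals all_analysis.
From mathcomp Require Import ring.

Set Implicit Arguments.
Unset Strict Implicit.
Unset Printing Implicit Defensive.

Import Order.TTheory GRing.Theory Num.Theory.
Import numFieldNormedType.Exports.

Local Open Scope classical_set_scope.
Local Open Scope ring_scope.

#[short(type="finNormedModType")]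
HB.structure Definition FinNormedModule (R : realType) :=
  {E of NormedModule R E & Vector R E}.

HB.instance Definition _ (R : realType) := Vector.on R^o.

HB.instance Definition _ (R : realType) m n := Vector.on 'M[R]_(m, n).

(** Matrices with the Euclidean (Frobenius) norm; an alias is needed because
    ['M[R]_(m, n)] canonically carries the sup norm. *)
Definition euclid (R : realType) (m n : nat) : Type := 'M[R]_(m, n).

HB.instance Definition _ (R : realType) m n :=
  Vector.copy (euclid R m n) 'M[R]_(m, n).

Section euclid_norm.
Context (R : realType) (m n : nat).
Implicit Types x y : euclid R m n.

Definition eucl_entry x (k : 'I_m * 'I_n) : R := (x : 'M[R]_(m, n)) k.1 k.2.

Definition eucl_norm x : R := Num.sqrt (\sum_k eucl_entry x k ^+ 2).

Let sumsq_ge0 (I : finType) (a : I -> R) : 0 <= \sum_k a k ^+ 2.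
Proof. by apply: sumr_ge0 => k _; exact: sqr_ge0. Qed.

Let CauchySchwarz (I : finType) (a b : I -> R) :
  (\sum_k a k * b k) ^+ 2 <= (\sum_k a k ^+ 2) * (\sum_k b k ^+ 2).
Proof.
have : 0 <= \sum_k \sum_l (a k * b l - a l * b k) ^+ 2.
  by apply: sumr_ge0 => k _; exact: sumsq_ge0.
have -> : \sum_k \sum_l (a k * b l - a l * b k) ^+ 2 =
    ((\sum_k a k ^+ 2) * (\sum_k b k ^+ 2) - (\sum_k a k * b k) ^+ 2) *+ 2.
  have e k l : (a k * b l - a l * b k) ^+ 2 =
      a k ^+ 2 * b l ^+ 2 + b k ^+ 2 * a l ^+ 2 - a k * b k * (a l * b l *+ 2).
    by ring.
  under eq_bigr => k _ do
    rewrite (eq_bigr _ (fun l _ => e k l)) sumrB big_split /= -!mulr_sumr.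
  by rewrite sumrB big_split /= -!mulr_suml sumrMnl; ring.
by rewrite pmulrn_lge0// subr_ge0.
Qed.

Lemma eucl_normD x y : eucl_norm (x + y) <= eucl_norm x + eucl_norm y.
Proof.
have N0 z : 0 <= eucl_norm z by exact: sqrtr_ge0.
rewrite -(@ler_pXn2r _ 2%N) ?nnegrE ?addr_ge0// sqrrD !sqr_sqrtr ?sumsq_ge0//.
have -> : \sum_k eucl_entry (x + y) k ^+ 2 = \sum_k eucl_entry x k ^+ 2 +
    (\sum_k eucl_entry x k * eucl_entry y k) *+ 2 + \sum_k eucl_entry y k ^+ 2.
  rewrite -sumrMnl -!big_split /=; apply: eq_bigr => k _.
  by rewrite -sqrrD /eucl_entry mxE.
rewrite lerD2r lerD2l lerMn2r /= /eucl_norm -sqrtrM ?sumsq_ge0//.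
by rewrite (le_trans (ler_norm _))// -sqrtr_sqr ler_wsqrtr// CauchySchwarz.
Qed.

Lemma eucl_normZ (l : R) x : eucl_norm (l *: x) = `|l| * eucl_norm x.
Proof.
rewrite /eucl_norm -sqrtr_sqr -sqrtrM ?sqr_ge0// mulr_sumr.
by congr Num.sqrt; apply: eq_bigr => k _; rewrite -exprMn /eucl_entry mxE.
Qed.

Lemma eucl_norm0_eq0 x : eucl_norm x = 0 -> x = 0.
Proof.
move=> /eqP; rewrite sqrtr_eq0 => le0.
have /eqP : \sum_k eucl_entry x k ^+ 2 = 0.
  by apply/eqP; rewrite eq_le le0 sumsq_ge0.
rewrite psumr_eq0 => [/allP x0|k _]; last exact: sqr_ge0.
apply/matrixP => i j; rewrite [RHS]mxE; apply/eqP.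
by have := x0 (i, j) (mem_index_enum _); rewrite sqrf_eq0.
Qed.

HB.instance Definition _ := Lmodule_isNormed.Build R (euclid R m n)
  eucl_normD eucl_normZ eucl_norm0_eq0.

Lemma eucl_normE x : `|x| = Num.sqrt (\sum_k eucl_entry x k ^+ 2).
Proof. by []. Qed.

Lemma eucl_entry_le x k : `|eucl_entry x k| <= `|x|.
Proof.
rewrite -sqrtr_sqr eucl_normE ler_wsqrtr//.
by rewrite (bigD1 k)//= lerDl sumr_ge0// => *; exact: sqr_ge0.
Qed.

End euclid_norm.

(** Y' takes values in [L(R^d ⊗ R^d, E)], normed as an operator space over
    [R^(d x d)]; an entrywise norm would make constants depend on [d]. *)
Section operator_norm.
Context (R : realType) (m n : nat) (E : finNormedModType R).
Implicit Types f g : 'Hom(euclid R m n, E).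

Definition opnorm f : R := sup [set `|f x| | x in [set x | `|x| <= 1]].

Let opnorm_has_sup f : has_sup [set `|f x| | x in [set x | `|x| <= 1]].
Proof.
split; first by exists `|f 0|, 0 => //=; rewrite normr0.
exists (\sum_(k : 'I_m * 'I_n) `|f (delta_mx k.1 k.2)|) => _ [x /= x1 <-].
have -> : x = \sum_(k : 'I_m * 'I_n)
    eucl_entry x k *: (delta_mx k.1 k.2 : euclid R m n).
  rewrite [LHS](matrix_sum_delta (x : 'M[R]_(m, n))) pair_big /=.
  by [].
rewrite linear_sum (le_trans (ler_norm_sum _ _ _))// ler_sum// => k _.
rewrite linearZ normrZ ler_piMl// (le_trans _ x1)//; exact: eucl_entry_le.
Qed.

Lemma opnorm_le f x : `|f x| <= opnorm f * `|x|.
Proof.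
have [->|x0] := eqVneq x 0; first by rewrite linear0 !normr0 mulr0.
rewrite -ler_pdivrMr ?normr_gt0//.
have -> : `|f x| / `|x| = `|f (`|x|^-1 *: x)|.
  by rewrite linearZ normrZ normfV normr_id mulrC.
apply: ub_le_sup; first by have [] := opnorm_has_sup f.
by exists (`|x|^-1 *: x) => //=; rewrite normrZ normfV normr_id mulVf ?normr_eq0.
Qed.

Lemma opnormD f g : opnorm (f + g) <= opnorm f + opnorm g.
Proof.
apply: ge_sup; first by have [] := opnorm_has_sup (f + g).
move=> _ [x /= x1 <-]; rewrite add_lfunE (le_trans (ler_normD _ _))//.
apply: lerD; apply: ub_le_sup; try by exists x.
- by have [] := opnorm_has_sup f.
- by have [] := opnorm_has_sup g.
Qed.

Let opnormZ_le (l : R) f : opnorm (l *: f) <= `|l| * opnorm f.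
Proof.
apply: ge_sup; first by have [] := opnorm_has_sup (l *: f).
move=> _ [x /= x1 <-]; rewrite scale_lfunE normrZ ler_wpM2l//.
by apply: ub_le_sup; [have [] := opnorm_has_sup f|exists x].
Qed.

Lemma opnormZ (l : R) f : opnorm (l *: f) = `|l| * opnorm f.
Proof.
apply/eqP; rewrite eq_le opnormZ_le /=.
have [->|l0] := eqVneq l 0.
  rewrite normr0 mul0r; apply: ub_le_sup; first by have [] := opnorm_has_sup (0 *: f).
  by exists 0 => /=; rewrite ?linear0 ?normr0.
rewrite -ler_pdivlMl ?normr_gt0// -normfV.
by rewrite -[X in opnorm X <= _](scalerK l0) opnormZ_le.
Qed.

Lemma opnorm0_eq0 f : opnorm f = 0 -> f = 0.
Proof.
move=> f0; apply/lfunP => x; rewrite zero_lfunE; apply/eqP.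
by rewrite -normr_le0 (le_trans (opnorm_le _ _))// f0 mul0r.
Qed.

HB.instance Definition _ := Lmodule_isNormed.Build R 'Hom(euclid R m n, E)
  opnormD opnormZ opnorm0_eq0.

Lemma lfun_normE f : `|f| = opnorm f. Proof. by []. Qed.

End operator_norm.

Section tensor.
Context (R : realType) (d : nat).

Definition tensor (x y : euclid R 1 d) : euclid R d d :=
  \matrix_(i, j) ((x : 'rV[R]_d) 0 i * (y : 'rV[R]_d) 0 j).

(** The identification L(R^d ⊗ R^d, E) ≅ L(R^d, L(R^d, E)):
    [curry_tensor A x] is the linear map [y |-> A (x ⊗ y)]; [linfun] is
    meaningful here since [tensor x] is linear, see [curry_tensorE]. *)
Definition curry_tensor (E : finNormedModType R) (A : 'Hom(euclid R d d, E))
  (x : euclid R 1 d) : 'Hom(euclid R 1 d, E) := linfun (A \o tensor x).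

Lemma curry_tensorE (E : finNormedModType R) (A : 'Hom(euclid R d d, E)) x y :
  curry_tensor A x y = A (tensor x y).
Proof.
have tl : linear (tensor x).
  by move=> a u v; apply/matrixP => i j; rewrite !mxE mulrDr mulrCA.
pose L := GRing.isLinear.Build _ _ _ _ (tensor x) tl.
pose t : {linear _ -> _} := HB.pack (tensor x) L.
by rewrite /curry_tensor (lfunE (A \o t)%FUN).
Qed.

End tensor.

(** Only the values on [0, T] of one-parameter functions, and on
    0 <= s <= t <= T of two-parameter ones, are meaningful. *)
Section paths.
Context (R : realType) (V : normedModType R).
Implicit Types (Z : R -> V) (W : R -> R -> V).

Definition incr Z (s t : R) : V := Z t - Z s.

(** The convention at 0 is [Z 0-] = [Z 0]. *)
Definition leftlim Z (t : R) : V := if t == 0 then Z 0 else lim (Z @ t^'-).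

Definition jump Z (t : R) : V := Z t - leftlim Z t.

Definition cadlag (T : R) Z : Prop :=
  (forall t, 0 <= t < T -> Z @ t^'+ --> Z t) /\
  (forall t, 0 < t <= T -> cvg (Z @ t^'-)).

(** A partition s = t_0 < t_1 < ... < t_k = t, satisfying [itv_partition s t P],
    is given by its tail [P = [:: t_1; ...; t_k]]; [cells s P] lists the pairs
    (t_i, t_(i+1)). *)
Definition cells (s : R) (P : seq R) : seq (R * R) := zip (s :: P) P.

Definition variation_norm (q : R) W (s t : R) : \bar R :=
  (ereal_sup [set (\sum_(c <- cells s P) `|W c.1 c.2| `^ q)%:E |
     P in itv_partition s t] `^ q^-1)%E.

Definition rrs_lim (S : seq R -> V) (s t : R) (L : V) : Prop :=
  forall eps : R, 0 < eps ->
    exists2 P0, itv_partition s t P0 &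
      forall P, itv_partition s t P -> {subset P0 <= P} -> `|S P - L| < eps.

End paths.

Section rough_paths.
Context (R : realType) (p T : R) (d : nat).
Implicit Types (X : R -> euclid R 1 d) (XX : R -> R -> euclid R d d).

Definition chen X XX : Prop :=
  forall s u t, 0 <= s -> s <= u -> u <= t -> t <= T ->
    XX s t - XX s u - XX u t = tensor (incr X s u) (incr X u t).

Definition rough_path X XX : Prop :=
  [/\ chen X XX,
      cadlag T (fun t => (incr X 0 t, XX 0 t)) &
      (variation_norm p (incr X) 0 T +
       variation_norm (p / 2) XX 0 T `^ 2^-1 < +oo)%E].

Definition XXtilde X XX (s t : R) : euclid R d d :=
  XX s t + tensor (jump X s) (incr X s t).

Context (E : finNormedModType R).
(** [DY] is the second component Y' of a controlled path (Y, Y'). *)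
Implicit Types (Y : R -> 'Hom(euclid R 1 d, E)) (DY : R -> 'Hom(euclid R d d, E)).

Definition remainder X Y DY (s t : R) : 'Hom(euclid R 1 d, E) :=
  incr Y s t - curry_tensor (DY s) (incr X s t).

Definition remainder_tilde X Y DY (s t : R) : 'Hom(euclid R 1 d, E) :=
  incr (leftlim Y) s t - curry_tensor (leftlim DY s) (incr (leftlim X) s t).

Definition controlled_path X Y DY : Prop :=
  [/\ cadlag T Y, cadlag T DY,
      (variation_norm p (incr Y) 0 T < +oo)%E,
      (variation_norm p (incr DY) 0 T < +oo)%E &
      (variation_norm (p / 2) (remainder X Y DY) 0 T < +oo)%E].

Definition germ_left X XX Y DY (s t : R) : E :=
  leftlim Y s (incr X s t) + leftlim DY s (XXtilde X XX s t).

Definition germ X XX Y DY (s t : R) : E :=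
  Y s (incr X s t) + DY s (XX s t).

(** The sums S and S' over a partition of an interval starting at [s]. *)
Definition sum_left X XX Y DY (s : R) (P : seq R) : E :=
  \sum_(c <- cells s P) germ_left X XX Y DY c.1 c.2.

Definition sum_right X XX Y DY (s : R) (P : seq R) : E :=
  \sum_(c <- cells s P) germ X XX Y DY c.1 c.2.

(** [I] is the common RRS limit of both sums, i.e. the integral of
    [Y_{r-}] against the rough path [(X, XX)] over [s, t]. *)
Definition is_rough_integral X XX Y DY (s t : R) (I : E) : Prop :=
  rrs_lim (sum_left X XX Y DY s) s t I /\
  rrs_lim (sum_right X XX Y DY s) s t I.

End rough_paths.

(* Main.v *)
Require Import Defs.
From mathcomp Require Import all_boot all_order all_algebra.
From mathcomp Require Import all_classical all_reals all_analysis.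
From mathcomp Require Import ring lra.

(** Both Riemann sums are governed by the additivity defect of their germ,
    [defect Xi a b c = Xi a c - Xi a b - Xi b c]. Chen's relation makes the defect
    of [germ] equal to minus
    [remainder X Y DY a b (incr X b c) + incr DY a b (XX b c)], and that of
    [germ_left] equal to the same expression with left limits in the first
    factors and [XXtilde] for [XX] ([defect_germ], [chen_tilde]). The factors have
    finite p/2- and p-variation, and 2/p + 1/p > 1, so that the defects are
    summable to the power w = p/3 < 1 along any partition ([sum_defect_powR_le]).

    Everything then follows from Young's argument of removing the points of a
    partition one at a time, in the form of [removal_bound]: passing from a
    partition P to a coarser one P0 costs a constant times the 1/w-th power of a
    bound on the sum of the w-th powers of the defects at points outside P0. The
    constant depends on w only. With P0 reduced to a single cell, this bounds the
    distance between the integral and one value of the germ, which gives both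
    estimates ([young_estimate]).

    For convergence, P0 is chosen to contain a finite set of points such that X, Y
    and DY move by at most a small eta over every interval (a, b] that avoids it
    ([cadlag_isolate_oscillation]). The defects at points b outside P0 are then
    small; raising the exponent w slightly turns smallness and
    summability into a small sum, and the sums over all refinements of P0 are close
    to each other ([sewing]). The value space is finite-dimensional, hence complete
    ([fin_normed_complete]), and the limit exists.

    Finally [germ a b - germ_left a b] is a sum of products of a jump at a and an
    increment over (a, b]. These products are again summable to the power p/3, the
    jumps being limits of increments over disjoint intervals ([sum_jumps_le]), and
    they are small over suitably fine partitions, so both sums have the same limit
    ([rrs_lim_germ_sub_germ_left]). *)

Set Implicit Arguments.
Unset Strict Implicit.
Unset Printing Implicit Defensive.

Import Order.TTheory GRing.Theory Num.Theory.
Import numFieldNormedType.Exports.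

Local Open Scope classical_set_scope.
Local Open Scope ring_scope.

(** * Powers and finite sums *)

Section power_sums.
Context (R : realType).
Implicit Types (a b c q x y u v w : R).

(** Grouping the indices between consecutive powers of 2 compares the sum with
    a geometric series of ratio [2 `^ (1 - a)]. *)
Lemma sum_inv_powR_bounded (a : R) : 1 < a ->
  exists2 K : R, 0 < K & forall n, \sum_(k < n) (k.+1%:R `^ a)^-1 <= K.
Proof.
move=> a1; pose r : R := (2 `^ (a - 1))^-1.
have pos (k : nat) : 0 <= ((k%:R : R) `^ a)^-1 by rewrite invr_ge0 powR_ge0.
have r0 : 0 < r by rewrite invr_gt0 powR_gt0.
have r1 : r < 1.
  rewrite invf_lt1 ?powR_gt0//.
  have := @gt0_ltr_powR R (a - 1); rewrite subr_gt0 => /(_ a1 1 2).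
  by rewrite powR1; apply; rewrite ?nnegrE// ltr1n.
exists (1 / (1 - r)) => [|n]; first by rewrite divr_gt0 ?subr_gt0.
have dyadic m : \sum_(1 <= k < 2 ^ m) (k%:R `^ a)^-1 <= \sum_(0 <= j < m) r ^+ j.
  elim: m => [|m IH]; first by rewrite expn0 !big_geq.
  rewrite (@big_cat_nat _ _ _ (2 ^ m)) ?expn_gt0 ?leq_exp2l//= big_nat_recr//=.
  rewrite lerD// big_seq_cond (le_trans (y := \sum_(2 ^ m <= k < 2 ^ m.+1) r ^+ m / (2 ^ m)%:R))//.
    rewrite -big_seq_cond big_nat_cond [leRHS]big_nat_cond ler_sum// => k.
    rewrite andbT => /andP[mk _].
    have m0 : 0 < ((2 ^ m)%:R : R) by rewrite ltr0n expn_gt0.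
    have -> : r ^+ m / (2 ^ m)%:R = ((2 ^ m)%:R `^ a)^-1.
      have -> : r ^+ m = ((2 ^ m)%:R `^ (a - 1))^-1.
        by rewrite exprVn natrX -[X in _ = (X `^ _)^-1]powR_mulrn// powRAC powR_mulrn ?powR_ge0.
      rewrite -invfM mulrC mulr_powRB1 ?(ltW m0)// (lt_trans ltr01)//.
    rewrite lef_pV2 ?posrE ?powR_gt0// ?(lt_le_trans m0) ?ler_nat//.
    by rewrite ge0_ler_powR ?nnegrE ?ler_nat// (le_trans ler01)// ltW.
  by rewrite sumr_const_nat expnS mul2n -addnn addnK -[X in X <= _]mulr_natr mulfVK//.
have le2 : (n < 2 ^ n)%N by rewrite ltn_expl.
rewrite -(big_mkord xpredT (fun k => (k.+1%:R `^ a)^-1)).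
rewrite -(big_add1 _ _ 0 n.+1 xpredT (fun k => (k%:R `^ a)^-1)).
rewrite (le_trans _ (le_trans (dyadic n) _))//.
  rewrite [leRHS](@big_cat_nat _ _ _ n.+1)//= lerDl sumr_ge0//.
by have := @geometric_le_lim R n 1 r ler01 r0; rewrite gtr0_norm// => /(_ r1);
  rewrite /series/=; under eq_bigr do rewrite mul1r.
Qed.

(** The larger of [x `^ u] and [y `^ v] already dominates. *)
Lemma powR_mul_le_add x y u v w : 0 <= x -> 0 <= y -> 0 < u -> 0 < v ->
  w^-1 = u^-1 + v^-1 -> (x * y) `^ w <= x `^ u + y `^ v.
Proof.
move=> x0 y0 u0 v0 ww.
have w0 : 0 < w by rewrite -invr_gt0 ww addr_gt0 ?invr_gt0.
pose m := Num.max (x `^ u) (y `^ v).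
have m0 : 0 <= m by rewrite le_max powR_ge0.
have xm : x <= m `^ u^-1.
  rewrite -[leLHS](powRr1 x0) -(mulfV (lt0r_neq0 u0)) powRrM.
  by rewrite ge0_ler_powR ?nnegrE ?powR_ge0 ?invr_ge0 ?(ltW u0)// le_max lexx.
have ym : y <= m `^ v^-1.
  rewrite -[leLHS](powRr1 y0) -(mulfV (lt0r_neq0 v0)) powRrM.
  by rewrite ge0_ler_powR ?nnegrE ?powR_ge0 ?invr_ge0 ?(ltW v0)// le_max lexx orbT.
apply: (@le_trans _ _ m); last first.
  by rewrite ge_max lerDl lerDr !powR_ge0.
have : x * y <= m `^ w^-1.
  rewrite ww powRD ?ler_pM//.
  by rewrite -ww invr_eq0 gt_eqF.
move=> /(ge0_ler_powR (ltW w0)); rewrite !nnegrE mulr_ge0// powR_ge0 => /(_ isT isT).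
by rewrite -powRrM mulVf ?gt_eqF// powRr1.
Qed.

(** The constant 2 is not optimal, but it avoids a convexity argument. *)
Lemma powRD_le x y w : 0 <= x -> 0 <= y -> 0 < w <= 1 ->
  (x + y) `^ w <= 2 * (x `^ w + y `^ w).
Proof.
move=> x0 y0 /andP[w0 w1].
pose m := Num.max x y.
have m0 : 0 <= m by rewrite le_max x0.
have xm : x <= m by rewrite le_max lexx.
have ym : y <= m by rewrite le_max lexx orbT.
apply: (@le_trans _ _ (2 * m `^ w)).
  apply: (@le_trans _ _ ((2 * m) `^ w)).
    by rewrite ge0_ler_powR ?nnegrE ?(ltW w0) ?addr_ge0 ?mulr_ge0//; lra.
  by rewrite powRM// ler_wpM2r ?powR_ge0// ler1_powR// ler1n.
rewrite ler_wpM2l// /m; by case: (leP x y) => _; [rewrite lerDr powR_ge0|rewrite lerDl powR_ge0].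
Qed.

Section seq_sums.
Context (I : eqType) (r : seq I) (f g : I -> R).
Hypotheses (f0 : forall i, 0 <= f i) (g0 : forall i, 0 <= g i).

(** A Hölder inequality with a lossy constant: after normalising [a] and [b]
    to 1 the terms are compared one by one. *)
Lemma sum_powR_mul_le a b u v w : 0 <= a -> 0 <= b -> 0 < u -> 0 < v ->
  w^-1 = u^-1 + v^-1 ->
  \sum_(i <- r) f i `^ u <= a `^ u -> \sum_(i <- r) g i `^ v <= b `^ v ->
  \sum_(i <- r) (f i * g i) `^ w <= 2 * (a * b) `^ w.
Proof.
move=> a0 b0 u0 v0 ww fa gb.
have w0 : 0 < w by rewrite -invr_gt0 ww addr_gt0 ?invr_gt0.
have vanish (h : I -> R) c q : 0 < q -> c = 0 -> \sum_(i <- r) h i `^ q <= c `^ q ->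
    {in r, forall i, h i = 0}.
  move=> q0 -> sle i ir; apply/eqP.
  have : \sum_(i <- r) h i `^ q == 0.
    rewrite eq_le sumr_ge0 ?andbT; last by move=> *; exact: powR_ge0.
    by rewrite (le_trans sle)// powR0// gt_eqF.
  rewrite psumr_eq0 => [/allP/(_ i ir)|]; last by move=> *; exact: powR_ge0.
  by rewrite powR_eq0 (gt_eqF q0) andbT.
have triv : {in r, forall i, f i * g i = 0} ->
    \sum_(i <- r) (f i * g i) `^ w <= 2 * (a * b) `^ w.
  move=> fg; rewrite big_seq big1; first by rewrite mulr_ge0 ?powR_ge0.
  by move=> i /fg ->; rewrite powR0// gt_eqF.
have [a00|an0] := eqVneq a 0.
  by apply: triv => i ir; rewrite (vanish f a u u0 a00 fa)// mul0r.
have [b00|bn0] := eqVneq b 0.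
  by apply: triv => i ir; rewrite (vanish g b v v0 b00 gb)// mulr0.
have {an0}a_gt0 : 0 < a by rewrite lt_neqAle eq_sym an0.
have {bn0}b_gt0 : 0 < b by rewrite lt_neqAle eq_sym bn0.
have norm1 (h : I -> R) c q : (forall i, 0 <= h i) -> 0 < q -> 0 < c ->
    \sum_(i <- r) h i `^ q <= c `^ q -> \sum_(i <- r) (h i / c) `^ q <= 1.
  move=> h0 q0 c0 sle; under eq_bigr do rewrite powRM ?invr_ge0 ?(ltW c0)//.
  rewrite -mulr_suml -(powR_inv1 (ltW c0)) powRAC powR_inv1 ?powR_ge0//.
  by rewrite ler_pdivrMr ?powR_gt0// mul1r.
rewrite -ler_pdivrMr ?powR_gt0 ?mulr_gt0// mulr_suml.
rewrite (_ : 2 = 1 + 1 :> R)//.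
apply: le_trans (lerD (norm1 f a u f0 u0 a_gt0 fa) (norm1 g b v g0 v0 b_gt0 gb)).
rewrite -big_split/= ler_sum// => i _.
apply: le_trans (powR_mul_le_add _ _ u0 v0 ww); rewrite ?divr_ge0//.
rewrite [leRHS](_ : _ = ((f i * g i) / (a * b)) `^ w); last first.
  by congr (_ `^ _); field; rewrite !gt_eqF.
rewrite [leRHS]powRM ?mulr_ge0 ?invr_ge0 ?mulr_ge0//.
by rewrite -[X in _ <= _ * (X `^ _)]powR_inv1 ?mulr_ge0// powRAC powR_inv1 ?powR_ge0.
Qed.

End seq_sums.

(** The pigeonhole principle: some term is at most the average. *)
Lemma seq_le_mean (I : eqType) (r : seq I) (f : I -> R) : r != [::] ->
  exists2 i, i \in r & f i * (size r)%:R <= \sum_(j <- r) f j.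
Proof.
move=> rn0; apply: contrapT => nex.
have lt i : i \in r -> \sum_(j <- r) f j < f i * (size r)%:R.
  by move=> ir; rewrite ltNge; apply/negP => le; apply: nex; exists i.
have s0 : (0 < size r)%N by case: r rn0 {nex lt}.
have sz : 0 < ((size r)%:R : R) by rewrite ltr0n.
have : \sum_(i <- r) (\sum_(j <- r) f j) / (size r)%:R < \sum_(i <- r) f i.
  rewrite big_seq [ltRHS]big_seq; apply: ltr_sum => [|i ir].
    by apply/hasP; case: r s0 {nex rn0 lt sz} => // i r' _; exists i; rewrite inE eqxx.
  by rewrite ltr_pdivrMr ?lt.
by rewrite big_const_seq count_predT iter_addr_0 -[_ *+ _]mulr_natr mulfVK ?ltxx// gt_eqF.
Qed.

End power_sums.

(** * Partitions and Riemann sums *)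

Section partitions.
Context (R : realType).
Implicit Types (s t a b x y : R) (P Q L : seq R).

(** Neighbouring cells (a, b) and (b, c) are kept as ((a, b), c), which makes the
    first cell a projection and leaves the removable point [b] in the middle. *)
Definition triples s P : seq (R * R * R) := zip (cells s P) (behead P).

Lemma cells_cons s x P : cells s (x :: P) = (s, x) :: cells x P.
Proof. by []. Qed.

Lemma cells_cat s P Q : cells s (P ++ Q) = cells s P ++ cells (last s P) Q.
Proof. by elim: P s => //= x P IH s; rewrite !cells_cons IH. Qed.

Lemma triples_cons s x y P : triples s (x :: y :: P) = (s, x, y) :: triples x (y :: P).
Proof. by []. Qed.

Lemma triples_split s P tr : tr \in triples s P ->
  exists l r, P = l ++ tr.1.2 :: tr.2 :: r /\ last s l = tr.1.1.
Proof.
elim: P s => [//|x [|y P] IH s //]; rewrite triples_cons inE => /orP[/eqP->|].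
  by exists [::], P.
by move=> /IH[l [r [-> <-]]]; exists (x :: l), r.
Qed.

Lemma triples_cells s P tr : tr \in triples s P ->
  tr.1 \in cells s P /\ (tr.1.2, tr.2) \in cells s P.
Proof.
case: tr => -[a b] c /triples_split/=[l [r [-> <-]]].
by rewrite !cells_cat !mem_cat /cells/= !inE !eqxx ?orbT.
Qed.

Lemma cells_itv_partition s t P a b : itv_partition s t P -> (a, b) \in cells s P ->
  [/\ s <= a < b, b <= t, a \in s :: P, b \in P &
      forall x, x \in P -> x <= a \/ b <= x].
Proof.
elim: P s => [//|x P IH s] xP.
have /= [/andP[sx xpath] _] := xP.
have xle y : y \in P -> x < y.
  by move=> yP; move: xpath => /lt_path_min/allP/(_ _ yP).
have xt : x <= t by exact: itv_partition_le (itv_partition_cons xP).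
rewrite cells_cons inE => /orP[/eqP[-> ->]|].
  rewrite lexx sx !inE !eqxx; split=> // y.
  by rewrite inE => /orP[/eqP->|/xle/ltW]; right.
move=> /(IH _ (itv_partition_cons xP))[/andP[xa ab] bt aP bP sep].
split=> //; rewrite ?inE ?bP ?orbT//.
- by rewrite ab (le_trans (ltW sx) xa).
- by move: aP; rewrite inE => ->; rewrite orbT.
- by move=> y; rewrite inE => /orP[/eqP->|/sep//]; left.
Qed.

Lemma itv_partition_mem s t P x : itv_partition s t P -> x \in P -> s < x <= t.
Proof.
move=> sP xP; have [spath _] := sP.
move: (spath) => /lt_path_min/allP/(_ _ xP) ->/=.
elim: P s sP xP {spath} => // y P IH s sP; rewrite inE => /orP[/eqP->|].
  exact: itv_partition_le (itv_partition_cons sP).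
exact: IH (itv_partition_cons sP).
Qed.

Lemma mem_itv_partition_last s t P : s < t -> itv_partition s t P -> t \in P.
Proof.
move=> st [_ /eqP lt]; have := mem_last s P; rewrite lt inE => /orP[/eqP ts|//].
by move: st; rewrite ts ltxx.
Qed.

Lemma itv_partition_ext s t P Q : itv_partition s t P -> itv_partition s t Q ->
  P =i Q -> P = Q.
Proof.
move=> [/path_sorted sP _] [/path_sorted sQ _]; exact: lt_sorted_eq.
Qed.

Lemma sum_triples_fst s P (F : R * R -> R) : (forall c, 0 <= F c) ->
  \sum_(tr <- triples s P) F tr.1 <= \sum_(c <- cells s P) F c.
Proof.
move=> F0; elim: P s => [s|x [_ s|y P IH s]]; [by rewrite !big_nil|by rewrite big_nil sumr_ge0|].
by rewrite triples_cons cells_cons big_cons [leRHS]big_cons lerD2l; exact: IH.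
Qed.

Lemma sum_triples_snd s P (F : R * R -> R) : (forall c, 0 <= F c) ->
  \sum_(tr <- triples s P) F (tr.1.2, tr.2) <= \sum_(c <- cells s P) F c.
Proof.
move=> F0; apply: (@le_trans _ _ (\sum_(c <- behead (cells s P)) F c)).
  elim: P s => [s|x [_ s|y P IH s]]; [by rewrite !big_nil|by rewrite big_nil sumr_ge0|].
  by rewrite triples_cons cells_cons big_cons [leRHS]big_cons lerD2l; exact: IH.
by case: (cells s P) => [|c l]; rewrite ?big_nil// big_cons lerDr.
Qed.

(** Points of [L] outside (s, t] are dropped and [t] is added, so that any finite
    list of points can be imposed on a partition. *)
Definition part_through s t L : seq R :=
  sort <=%O (undup [seq x <- t :: L | s < x <= t]).

Lemma mem_part_through s t L x :
  (x \in part_through s t L) = (x \in t :: L) && (s < x <= t).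
Proof. by rewrite mem_sort mem_undup mem_filter andbC. Qed.

Lemma part_throughP s t L : s <= t -> itv_partition s t (part_through s t L).
Proof.
move=> st; have sorted_P : sorted <%O (part_through s t L).
  by rewrite lt_sorted_uniq_le sort_uniq undup_uniq sort_le_sorted.
have gt_s x : x \in part_through s t L -> s < x.
  by rewrite mem_part_through => /andP[_ /andP[]].
split.
  rewrite path_sortedE; last exact: lt_trans.
  by rewrite sorted_P andbT; apply/allP => x /gt_s.
have [<-|s_lt] := eqVneq s t.
  case: (part_through s s L) (mem_part_through s s L) => //= x l mem.
  by have := mem x; rewrite inE eqxx => /esym/andP[_ /andP[/lt_le_trans h /h]]; rewrite ltxx.
have {st}s_lt : s < t by rewrite lt_neqAle s_lt.
have tP : t \in part_through s t L by rewrite mem_part_through inE eqxx s_lt lexx.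
rewrite eq_le; apply/andP; split.
  have := mem_last s (part_through s t L); rewrite inE => /orP[/eqP->|].
    exact: ltW.
  by rewrite mem_part_through => /andP[_ /andP[]].
move: (part_through s t L) sorted_P tP {gt_s s_lt} => l.
elim: l s => //= x l IH s xl; rewrite inE => /orP[/eqP->|tl]; last first.
  by apply: IH => //; exact: path_sorted xl.
have := mem_last x l; rewrite inE => /orP[/eqP->//|].
by move: xl => /lt_path_min/allP xl /xl/ltW.
Qed.

Lemma common_refinement s t P Q : itv_partition s t P -> itv_partition s t Q ->
  exists P', [/\ itv_partition s t P', {subset P <= P'} & {subset Q <= P'}].
Proof.
move=> sP sQ; exists (part_through s t (P ++ Q)).
split; first exact/part_throughP/itv_partition_le/sP.
  by move=> x xP; rewrite mem_part_through inE mem_cat xP orbT (itv_partition_mem sP).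
by move=> x xQ; rewrite mem_part_through inE mem_cat xQ !orbT (itv_partition_mem sQ).
Qed.

Section riemann_sums.
Context (V : normedModType R).
Implicit Types (Xi : R -> R -> V).

Definition riemann_sum Xi s P : V := \sum_(c <- cells s P) Xi c.1 c.2.

(** For an additive germ Riemann sums do not depend on the partition; the defect
    is what a single refinement changes. *)
Definition defect Xi a b c : V := Xi a c - Xi a b - Xi b c.

Lemma riemann_sum_remove Xi s l b c r :
  riemann_sum Xi s (l ++ b :: c :: r) =
  riemann_sum Xi s (l ++ c :: r) - defect Xi (last s l) b c.
Proof.
rewrite /riemann_sum !cells_cat !big_cat/= !cells_cons !big_cons/= -addrA.
congr (_ + _); rewrite /defect !opprB.
move: (Xi (last s l) c) (Xi (last s l) b) (Xi b c) => w u v.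
by rewrite addrAC (addrCA w) (addrCA w) subrr addr0 -addrA addrCA.
Qed.

End riemann_sums.
End partitions.

(** * Removing points from a partition *)

Section removal.
Context (R : realType).

Lemma size_removable_triples (s : R) (P P0 : seq R) : last s P \in P0 ->
  size [seq tr <- triples s P | tr.1.2 \notin P0] = count [predC P0] P.
Proof.
elim: P s => [//|x [_ s /= ->//|y P IH s lP]].
rewrite triples_cons; move: (triples x (y :: P)) (IH x lP) => l /= lE.
by case: (x \notin P0); rewrite /= lE.
Qed.

(** Young's argument. Among the points of [P] outside [P0], say [n] of them, one
    has defect at most [(W / n) `^ w^-1], by the pigeonhole principle; remove it
    and continue until [P0] is left. The errors add up to [W `^ w^-1] times a
    partial sum of the convergent series of [n `^ (- w^-1)].
    Only points outside [P0] are ever removed, so the hypothesis ignores the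
    possibly large defects at the points of [P0]. *)
Lemma removal_bound (w : R) : 0 < w < 1 -> exists2 K : R, 0 < K &
  forall (V : normedModType R) (Xi : R -> R -> V) (s t : R) (P0 : seq R) (W : R),
  itv_partition s t P0 ->
  (forall P, itv_partition s t P -> {subset P0 <= P} ->
     \sum_(tr <- triples s P | tr.1.2 \notin P0)
        `|defect Xi tr.1.1 tr.1.2 tr.2| `^ w <= W) ->
  forall P, itv_partition s t P -> {subset P0 <= P} ->
    `|riemann_sum Xi s P - riemann_sum Xi s P0| <= K * W `^ w^-1.
Proof.
move=> /andP[w0 w1].
have [|K K0 zetaK] := @sum_inv_powR_bounded R w^-1; first by rewrite invf_gt1.
exists K => // V Xi s t P0 W sP0 defW P sP P0P.
have W0 : 0 <= W.
  by apply: le_trans (defW _ sP P0P); rewrite sumr_ge0// => *; exact: powR_ge0.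
suff : `|riemann_sum Xi s P - riemann_sum Xi s P0| <=
    (\sum_(k < count [predC P0] P) (k.+1%:R `^ w^-1)^-1) * W `^ w^-1.
  by move=> /le_trans; apply; rewrite ler_wpM2r ?powR_ge0.
have lastP0 Q : itv_partition s t Q -> Q != [::] -> last s Q \in P0.
  move=> sQ Q0; have [_ /eqP ->] := sQ.
  by rewrite (mem_itv_partition_last _ sP0)// (itv_partition_size_neq0 _ sQ)//; case: Q Q0 {sQ}.
have [n] := ubnP (count [predC P0] P); move eqn : (count _ P) => m.
elim: m n P sP P0P eqn => [|m IH] n P sP P0P eqn _.
  rewrite (itv_partition_ext sP sP0) ?subrr ?normr0 ?mulr_ge0 ?powR_ge0//.
    by rewrite big_ord0.
  move=> x; apply/idP/idP => [xP|/P0P//].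
  by move: eqn => /eqP; rewrite -leqn0 leqNgt -has_count => /hasPn/(_ x xP); rewrite /= negbK.
have P_neq0 : P != [::] by apply/eqP => P0'; move: eqn; rewrite P0'.
pose F := [seq tr <- triples s P | tr.1.2 \notin P0].
have sizeF : size F = m.+1.
  by rewrite size_removable_triples// lastP0.
have [|tr] := @seq_le_mean R _ F (fun tr => `|defect Xi tr.1.1 tr.1.2 tr.2| `^ w).
  by rewrite -size_eq0 sizeF.
rewrite mem_filter => /andP[trP0 trP]; rewrite sizeF big_filter => tr_small.
have [l [r [defP last_l]]] := triples_split trP.
have /andP[/lt_trans lt_b lt_c] : (last s l < tr.1.2) && (tr.1.2 < tr.2).
  by have [] := sP; rewrite defP cat_path/= => /andP[_ /and3P[-> ->]].
have sP' : itv_partition s t (l ++ tr.2 :: r).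
  move: sP; rewrite defP => -[+ +]; rewrite !cat_path/= !last_cat/=.
  move=> /andP[pl /and3P[_ _ pr]] lt; split; last by rewrite last_cat.
  by rewrite cat_path/= pl lt_b// last_l.
have P0P' : {subset P0 <= l ++ tr.2 :: r}.
  move=> x xP0; move: (P0P _ xP0); rewrite defP !mem_cat !inE.
  by have [xtr|//] := eqVneq x tr.1.2; move: xP0; rewrite xtr (negPf trP0).
have countP' : count [predC P0] (l ++ tr.2 :: r) = m.
  by move: eqn; rewrite defP !count_cat/= trP0 add1n addnS => -[].
rewrite [in leLHS]defP riemann_sum_remove addrAC (le_trans (ler_normB _ _))//.
rewrite big_ord_recr/= mulrDl lerD ?(IH m.+1)// last_l.
rewrite -[leLHS](powRr1 (normr_ge0 _)) -[X in _ `^ X <= _](mulfV (lt0r_neq0 w0)) powRrM.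
rewrite -[X in _ <= X * _]powR_inv1 ?powR_ge0// [X in _ <= X * _]powRAC powR_inv1//.
rewrite mulrC -powRM ?invr_ge0//.
rewrite ge0_ler_powR ?nnegrE ?powR_ge0 ?invr_ge0 ?(ltW w0) ?divr_ge0//.
by rewrite ler_pdivlMr ?ltr0n// (le_trans tr_small)// defW.
Qed.

End removal.

(** * Completeness of finite-dimensional normed spaces *)

Import VectorInternalTheory.

Section completeness.
Context (R : realType) (E : finNormedModType R).

Lemma le_norm_row n (u : 'rV[R]_n) i : `|u 0 i| <= `|u|.
Proof.
rewrite [leRHS]/Num.norm/= mx_normrE.
exact: (@le_bigmax _ R _ 0 (fun ij : 'I_1 * 'I_n => `|u ij.1 ij.2|) (0, i)).
Qed.

Lemma norm_r2v_le : exists2 M : R, 0 < M & forall u, `|r2v u : E| <= M * `|u|.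
Proof.
exists (1 + \sum_i `|r2v (delta_mx 0 i) : E|) => [|u].
  by rewrite ltr_pwDl// sumr_ge0.
rewrite [in leLHS](row_sum_delta u) linear_sum (le_trans (ler_norm_sum _ _ _))//.
rewrite mulrDl mul1r mulr_suml ler_wpDl// ler_sum// => i _.
by rewrite linearZ normrZ mulrC ler_wpM2l// le_norm_row.
Qed.

(** Norms on a finite-dimensional space are equivalent: the norm of [E] is
    continuous and positive on the compact unit sphere of the coordinates. *)
Lemma norm_v2r_le : exists2 K : R, 0 < K & forall x : E, `|v2r x| <= K * `|x|.
Proof.
have [M M0 r2vM] := norm_r2v_le.
pose f u : R := `|r2v u : E|.
pose sphere : set 'rV[R]_(dim E) := [set u | `|u| = 1].
have unit_sphere (u : 'rV[R]_(dim E)) : u != 0 -> sphere (`|u|^-1 *: u).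
  by move=> u0; rewrite /sphere/= normrZ normfV normr_id mulVf// normr_eq0.
have [sphere_empty|/set0P sphere0] := eqVneq sphere set0.
  exists 1 => // x; have [->|/unit_sphere] := eqVneq (v2r x) 0.
    by rewrite normr0 mulr_ge0.
  by rewrite sphere_empty.
have f_cont : continuous f.
  move=> u; apply/(@cvgrPdist_lt _ _ _ (nbhs u) (nbhs_filter u)) => e e0.
  have /(@cvgrPdist_lt _ _ _ (nbhs u) (nbhs_filter u))/(_ (M^-1 * e)) :
    id @ nbhs u --> u by exact: cvg_id.
  rewrite mulr_gt0 ?invr_gt0// => /(_ isT); apply: filterS => v uv.
  rewrite (le_lt_trans (ler_dist_dist _ _))// -linearB (le_lt_trans (r2vM _))//.
  by rewrite -ltr_pdivlMl.
have sphere_compact : compact sphere.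
  apply: bounded_closed_compact.
    exists 1; split=> // y y1 u /= ->; exact: ltW.
  apply: (@preimage_closed _ _ (fun u : 'rV[R]_(dim E) => `|u|) [set 1%R]).
    by move=> u _; exact: norm_continuous.
  exact: closed_eq.
have [c] := EVT_min_rV sphere0 sphere_compact (continuous_subspaceT f_cont).
rewrite inE => sc fmin.
have c0 : 0 < f c.
  rewrite normr_gt0; apply: contra_eq_neq sc => rc0.
  by rewrite -[c]r2vK rc0 linear0 normr0 eq_sym oner_eq0.
exists (f c)^-1 => [|x]; first by rewrite invr_gt0.
have [->|vx0] := eqVneq (v2r x) 0; first by rewrite normr0 mulr_ge0 ?invr_ge0 ?(ltW c0).
have := fmin _ (mem_set (unit_sphere _ vx0)).
rewrite [leRHS]/f linearZ normrZ normfV normr_id/= v2rK.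
by rewrite ler_pdivlMl ?normr_gt0// mulrC -ler_pdivlMl.
Qed.

(** Completeness is transported from the coordinate space. *)
Lemma fin_normed_complete (F : set_system E) : ProperFilter F -> cauchy F -> cvg F.
Proof.
move=> FF Fcauchy.
have [K K0 v2rK_le] := norm_v2r_le; have [M M0 r2vM] := norm_r2v_le.
have /cauchy_cvg/cvg_ex[/= u Fu] : cauchy (v2r @ F).
  apply: cauchy_exP => e e0.
  have /cauchyP/(_ (e / K)) := Fcauchy; rewrite divr_gt0// => /(_ isT)[x Fx].
  exists (v2r x); change (F (v2r @^-1` ball (v2r x) e)).
  apply: filterS Fx => y; rewrite /= -!ball_normE /ball_/= => xy.
  rewrite -linearB (le_lt_trans (v2rK_le _))// -ltr_pdivlMl//.
  by rewrite mulrC.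
apply/cvg_ex; exists (r2v u); apply/cvgrPdist_lt => e e0.
have /cvgrPdist_lt/(_ (e / M)) := Fu; rewrite divr_gt0// => /(_ isT).
apply: filterS => x /= ux; rewrite -[x]v2rK -linearB (le_lt_trans (r2vM _))//.
by rewrite -ltr_pdivlMl// mulrC.
Qed.

End completeness.

(** * Refinement limits and sewing *)

Section refinement_limits.
Context (R : realType).
Implicit Types (s t : R) (P : seq R).

(** The sets containing every partition finer than some given one: the filter
    along which a refinement Riemann-Stieltjes limit is taken. *)
Definition refinement_filter s t : set_system (seq R) :=
  [set A | exists2 P0, itv_partition s t P0 &
     forall P, itv_partition s t P -> {subset P0 <= P} -> A P].

Lemma refinement_filter_proper s t : s <= t -> ProperFilter (refinement_filter s t).
Proof.
move=> st; apply: Build_ProperFilter_ex; last split.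
- by move=> A [P0 sP0 AP0]; exists P0; exact: AP0.
- by exists (part_through s t [::]) => //; exact: part_throughP.
- move=> A B [P sP AP] [Q sQ BQ].
  have [P' [sP' PP' QP']] := common_refinement sP sQ.
  by exists P' => // S sS sub; split; [apply: AP|apply: BQ] => // x /[dup];
    [move/PP'/sub|move/QP'/sub].
- by move=> A B AB [P sP AP]; exists P => // Q sQ PQ; exact/AB/AP.
Qed.

Lemma rrs_limP (V : normedModType R) (S : seq R -> V) s t L : s <= t ->
  rrs_lim S s t L <-> S @ refinement_filter s t --> L.
Proof.
move=> st; have FF := refinement_filter_proper st.
split=> [SL|/cvgrPdist_lt SL e e0].
  apply/cvgrPdist_lt => e /SL[P0 sP0 H]; exists P0 => // P sP PP0.
  by rewrite /= distrC H.
by have [P0 sP0 H] := SL e e0; exists P0 => // P sP PP0; rewrite distrC; exact: H.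
Qed.

Lemma rrs_cauchy_lim (E : finNormedModType R) (S : seq R -> E) s t : s <= t ->
  (forall e, 0 < e -> exists2 P0, itv_partition s t P0 &
     forall P, itv_partition s t P -> {subset P0 <= P} -> `|S P - S P0| < e) ->
  exists I, rrs_lim S s t I.
Proof.
move=> st SC; have FF := refinement_filter_proper st.
suff /fin_normed_complete/cvg_ex[I SI] : cauchy (S @ refinement_filter s t).
  by exists I; apply/rrs_limP.
apply: cauchy_exP => e /SC[P0 sP0 H]; exists (S P0), P0 => // P sP PP0.
by rewrite /= -ball_normE /ball_/= distrC H.
Qed.

Lemma rrs_lim_le (V : normedModType R) (S : seq R -> V) s t I v (B : R) :
  rrs_lim S s t I -> (forall P, itv_partition s t P -> `|S P - v| <= B) ->
  `|I - v| <= B.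
Proof.
move=> SI SB; apply/ler_addgt0Pr => e /SI[P sP /(_ P sP)/(_ (fun=> id)) SPI].
rewrite -(subrK (S P) I) -addrA addrC (le_trans (ler_normD _ _))//.
by rewrite lerD ?SB// distrC ltW.
Qed.

(** Summands that are uniformly small gain summability: this is what turns a
    finite sum of [w]-th powers into a small sum of [w']-th powers. *)
Lemma sum_powR_interpolate (I : eqType) (r : seq I) (p : pred I) (f : I -> R)
    (w w' eta : R) : 0 < w -> w <= w' -> (forall i, 0 <= f i) ->
  (forall i, i \in r -> p i -> f i <= eta) ->
  \sum_(i <- r | p i) f i `^ w' <= eta `^ (w' - w) * \sum_(i <- r) f i `^ w.
Proof.
move=> w0 ww' f0 fe; rewrite mulr_sumr big_mkcond [leLHS]big_seq [leRHS]big_seq.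
apply: ler_sum => i ir; case: ifPn => pi; last by rewrite mulr_ge0 ?powR_ge0.
rewrite -[in leLHS](subrK w w') [in leLHS]powRD; last first.
  by rewrite subrK gt_eqF// (lt_le_trans w0).
rewrite ler_wpM2r ?powR_ge0// ge0_ler_powR ?nnegrE ?subr_ge0//; last exact: fe.
exact: le_trans (f0 i) (fe i ir pi).
Qed.

Lemma exists_powR_mul_lt (k W e : R) : 0 < k -> 0 <= W -> 0 < e ->
  exists2 eta : R, 0 < eta & eta `^ k * W < e.
Proof.
move=> k0 W0 e0; have W10 : 0 < W + 1 by rewrite ltr_wpDl.
exists ((e / (W + 1)) `^ k^-1); first by rewrite powR_gt0// divr_gt0.
rewrite -powRrM mulVf ?gt_eqF// powRr1 ?divr_ge0 ?(ltW e0) ?(ltW W10)//.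
by rewrite mulrAC ltr_pdivrMr// ltr_pM2l// ltrDl.
Qed.

(** The sewing lemma for refinement limits. Refining a partition [P0] changes
    the Riemann sum by defects based at points outside [P0], and these are
    small once [P0] has isolated the large ones. *)
Lemma sewing (E : finNormedModType R) (Xi : R -> R -> E) s t (w W : R) :
  0 < w < 1 -> s <= t ->
  (forall P, itv_partition s t P ->
     \sum_(tr <- triples s P) `|defect Xi tr.1.1 tr.1.2 tr.2| `^ w <= W) ->
  (forall eta, 0 < eta -> exists2 P0, itv_partition s t P0 &
     forall P tr, itv_partition s t P -> {subset P0 <= P} -> tr \in triples s P ->
       tr.1.2 \notin P0 -> `|defect Xi tr.1.1 tr.1.2 tr.2| <= eta) ->
  exists I, rrs_lim (riemann_sum Xi s) s t I.
Proof.
move=> /andP[w0 w1] st defW small; apply: rrs_cauchy_lim => // e e0.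
(* Any exponent strictly between [w] and 1 works: the gap to [w] produces the
   small factor, and being below 1 keeps the removal series convergent. *)
pose w' := (w + 1) / 2.
have ww' : w < w' by rewrite /w'; lra.
have w'0 : 0 < w' by rewrite (lt_trans w0).
have [|K K0 HK] := @removal_bound R w'; first by rewrite w'0 /w'; lra.
have W0 : 0 <= W.
  by apply: le_trans (defW _ (part_throughP [::] st)); rewrite sumr_ge0// => *; exact: powR_ge0.
have ww'0 : 0 < w' - w by rewrite subr_gt0.
have eK0 : 0 < (e / K) `^ w' by rewrite powR_gt0// divr_gt0.
have [eta eta0 etaW] := exists_powR_mul_lt ww'0 W0 eK0.
have [P0 sP0 P0small] := small eta eta0.
exists P0 => // P sP P0P.
apply: (@le_lt_trans _ _ (K * (eta `^ (w' - w) * W) `^ w'^-1)).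
  apply: (HK E Xi s t) => // Q sQ P0Q.
  apply: (le_trans (sum_powR_interpolate w0 (ltW ww') (fun=> normr_ge0 _) _)).
    by move=> tr trQ trP0; exact: (P0small Q).
  by rewrite ler_wpM2l ?powR_ge0// defW.
rewrite -ltr_pdivlMl// [ltRHS]mulrC -[ltRHS](powRr1 (ltW (divr_gt0 e0 K0))).
rewrite -[X in _ < _ `^ X](mulfV (lt0r_neq0 w'0)).
rewrite powRrM gt0_ltr_powR ?invr_gt0 ?nnegrE ?powR_ge0//.
by rewrite mulr_ge0 ?powR_ge0.
Qed.

(** The same interpolation, with [1] as the larger exponent, for a germ whose own
    values are summable to a power below 1. *)
Lemma rrs_lim_null (V : normedModType R) (D : R -> R -> V) s t (w W : R) :
  0 < w < 1 -> s <= t ->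
  (forall P, itv_partition s t P ->
     \sum_(c <- cells s P) `|D c.1 c.2| `^ w <= W) ->
  (forall eta, 0 < eta -> exists2 P0, itv_partition s t P0 &
     forall P c, itv_partition s t P -> {subset P0 <= P} -> c \in cells s P ->
       `|D c.1 c.2| <= eta) ->
  rrs_lim (riemann_sum D s) s t 0.
Proof.
move=> /andP[w0 w1] st DW small e e0.
have W0 : 0 <= W.
  by apply: le_trans (DW _ (part_throughP [::] st)); rewrite sumr_ge0// => *; exact: powR_ge0.
have w10 : 0 < 1 - w by rewrite subr_gt0.
have [eta eta0 etaW] := exists_powR_mul_lt w10 W0 e0.
have [P0 sP0 P0small] := small eta eta0.
exists P0 => // P sP P0P; rewrite subr0 (le_lt_trans (ler_norm_sum _ _ _))//.
under eq_bigr do rewrite -[`|_|]powRr1//.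
apply: le_lt_trans etaW.
apply: (le_trans (sum_powR_interpolate w0 (ltW w1) (fun=> normr_ge0 _) _)).
  by move=> c cP _; exact: (P0small P).
by rewrite ler_wpM2l ?powR_ge0// DW.
Qed.

End refinement_limits.

(** * Cadlag paths *)

Section cadlag_paths.
Context (R : realType) (V : normedModType R).
Implicit Types (Z : R -> V) (s t a b c x y T eta : R) (L : seq R).

Lemma left_lim_near Z c l e : Z @ c^'- --> l -> 0 < e ->
  exists2 d, 0 < d & forall x, c - d < x -> x < c -> `|l - Z x| <= e.
Proof.
move=> /cvgrPdist_le Zl e0; have /nbhs_ballP[d /= d0 H] := Zl e e0.
exists d => // x cdx xc; apply: H => //.
by rewrite /ball/= ltr_norml; apply/andP; split; lra.
Qed.

Lemma right_lim_near Z c l e : Z @ c^'+ --> l -> 0 < e ->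
  exists2 d, 0 < d & forall x, c < x -> x < c + d -> `|l - Z x| <= e.
Proof.
move=> /cvgrPdist_le Zl e0; have /nbhs_ballP[d /= d0 H] := Zl e e0.
exists d => // x cx cdx; apply: H => //.
by rewrite /ball/= ltr_norml; apply/andP; split; lra.
Qed.

(** The interval without points of [L] is (a, b]: a right-continuous path may have
    a large jump at [a], which its increment over (a, b] does not see, but not
    at [b]. *)
Definition unseparated L a b := forall x, x \in L -> x <= a \/ b < x.

(** Finitely many points absorb the large oscillations of a cadlag path. The
    property holds up to the supremum [c] of the points up to which it holds, as
    the left limit at [c] controls the increments just before [c]; if [c < t],
    right continuity at [c] carries it further. *)
Lemma cadlag_isolate_oscillation T Z s t eta : cadlag T Z ->
  0 <= s -> s <= t -> t <= T -> 0 < eta ->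
  exists L, forall a b, s <= a -> a <= b -> b <= t -> unseparated L a b ->
    `|incr Z a b| <= eta.
Proof.
move=> [Zright Zleft] s0 st tT eta0.
pose good x := exists L, forall a b, s <= a -> a <= b -> b <= x ->
  unseparated L a b -> `|incr Z a b| <= eta.
pose A := [set x | s <= x <= t /\ good x].
have e20 : 0 < eta / 2 by rewrite divr_gt0.
have As : A s.
  split; first by rewrite lexx.
  exists [::] => a b sa ab bs _; have -> : a = b by lra.
  by rewrite /incr subrr normr0 ltW.
have supA : has_sup A by split; [exists s|exists t => x [/andP[]]].
have sc : s <= sup A by apply: ub_le_sup => //; case: supA.
have ct : sup A <= t by apply: ge_sup; [exists s|move=> x [/andP[]]].
move: (sup A) (@sup_adherent _ A) (@ub_le_sup _ A) sc ct => c c_adh c_ub sc ct.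
have two_close u v l : `|l - u| <= eta / 2 -> `|l - v| <= eta / 2 -> `|v - u : V| <= eta.
  move=> lu lv; rewrite -(subrK l v) -addrA (le_trans (ler_normD _ _))// distrC.
  lra.
have [L goodL] : good c.
  have [<-|s_neq_c] := eqVneq s c; first by case: As.
  have s_lt_c : s < c by rewrite lt_neqAle s_neq_c.
  have [|d d0 Hd] := left_lim_near (Zleft c _) e20; first by apply/andP; split; lra.
  have [y [/andP[sy yt] [L Ly]] cdy] := c_adh d d0 supA.
  exists (y :: c :: L) => a b sa ab bc sep.
  have sepL : unseparated L a b by move=> x xL; apply: sep; rewrite !inE xL !orbT.
  have [by_|yb] := leP b y; first exact: Ly.
  have [ya|] := sep y (mem_head _ _); last by move=> /(lt_trans yb); rewrite ltxx.
  have [ca|bc'] : c <= a \/ b < c by apply: sep; rewrite !inE eqxx orbT.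
    have -> : a = b by lra.
    by rewrite /incr subrr normr0 ltW.
  apply: two_close; apply: Hd; lra.
have [ct'|] := ltP c t; last first.
  by move=> tc; exists L => a b sa ab bt; apply: goodL => //; exact: le_trans tc.
have [|d d0 Hd] := right_lim_near (Zright c _) e20; first by apply/andP; split; lra.
pose z := Num.min t (c + d / 2).
have [cz zt zd] : [/\ c < z, z <= t & z < c + d].
  by rewrite /z; case: (leP t (c + d / 2)) => ?; split; lra.
suff : z <= c by rewrite leNgt cz.
apply: c_ub; first by case: supA.
split; first by apply/andP; split; lra.
exists (c :: L) => a b sa ab bz sep.
have [bc|cb] := leP b c.
  by apply: goodL => // x xL; apply: sep; rewrite inE xL orbT.
have [ca|] := sep c (mem_head _ _); last by move=> /(lt_trans cb); rewrite ltxx.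
have near_c x : c <= x -> x <= z -> `|Z c - Z x| <= eta / 2.
  rewrite le_eqVlt => /orP[/eqP<- _|cx xz]; first by rewrite subrr normr0 ltW.
  by apply: Hd; lra.
by apply: two_close; apply: near_c; lra.
Qed.

Lemma jump0 Z : jump Z 0 = 0.
Proof. by rewrite /jump /leftlim eqxx subrr. Qed.

Lemma leftlim_cvg T Z x : cadlag T Z -> 0 < x -> x <= T ->
  Z @ x^'- --> leftlim Z x.
Proof.
move=> [_ Zl] x0 xT; rewrite /leftlim gt_eqF//.
by apply: Zl; rewrite x0.
Qed.

Lemma incr_cvg_jump T Z x : cadlag T Z -> 0 < x -> x <= T ->
  (fun r => incr Z r x) @ x^'- --> jump Z x.
Proof.
move=> Zc x0 xT; apply: cvgB; first exact: cvg_cst.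
exact: leftlim_cvg Zc x0 xT.
Qed.

Lemma jump_le Z T a x eta : cadlag T Z -> 0 <= a -> a < x -> x <= T ->
  (forall y, a < y -> y < x -> `|incr Z y x| <= eta) -> `|jump Z x| <= eta.
Proof.
move=> Zc a0 ax xT H.
have x0 : 0 < x by exact: le_lt_trans ax.
have Zl := leftlim_cvg Zc x0 xT; apply/ler_addgt0Pr => e e0.
have [d d0 Hd] := left_lim_near Zl e0.
pose y := (Num.max a (x - d) + x) / 2.
have [ay [yx dy]] : a < y /\ y < x /\ x - d < y.
  by rewrite /y; case: (leP a (x - d)) => ?; split; [lra|split; lra|lra|split; lra].
have -> : jump Z x = incr Z y x - (leftlim Z x - Z y).
  by rewrite /jump /incr opprB addrA subrK.
by rewrite (le_trans (ler_normB _ _))// lerD ?H ?Hd.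
Qed.

(** For nonzero [l] the factor 2 leaves room for an actual value of [f] near its
    limit, and that value can be taken as close to [x] as needed. *)
Lemma left_lim_le_value (f : R -> V) x l a :
  f @ x^'- --> l -> a < x -> exists y, [/\ a < y, y < x & `|l| <= 2 * `|f y|].
Proof.
move=> fl ax; have [->|l0] := eqVneq l 0.
  by exists ((a + x) / 2); rewrite normr0 mulr_ge0//; split=> //; lra.
have l20 : 0 < `|l| / 2 by rewrite divr_gt0 ?normr_gt0.
have [dl dl0 near_x] := left_lim_near fl l20.
have [y [ay yx dy]] : exists y, [/\ a < y, y < x & x - dl < y].
  exists ((Num.max a (x - dl) + x) / 2).
  by case: (leP a (x - dl)) => ?; split; lra.
exists y; split=> //; have := near_x y dy yx.
have : `|l| <= `|l - f y| + `|f y| by rewrite -[in leLHS](subrK (f y) l) ler_normD.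
lra.
Qed.

End cadlag_paths.

(** * Germs and their defects *)

Section operator_norms.
Context (R : realType) (d : nat).
Implicit Types (x y : euclid R 1 d).

Lemma tensorDl x x' y : tensor (x + x') y = tensor x y + tensor x' y.
Proof. by apply/matrixP => i j; rewrite !mxE mulrDl. Qed.

Lemma tensorNl x y : tensor (- x) y = - tensor x y.
Proof. by apply/matrixP => i j; rewrite !mxE mulNr. Qed.

Lemma tensor0r x : tensor x 0 = 0.
Proof. by apply/matrixP => i j; rewrite !mxE mulr0. Qed.

Lemma norm_tensor x y : `|tensor x y| = `|x| * `|y|.
Proof.
rewrite !eucl_normE -sqrtrM; last by apply: sumr_ge0 => k _; exact: sqr_ge0.
have row (z : euclid R 1 d) :
    \sum_k eucl_entry z k ^+ 2 = \sum_j (z : 'rV[R]_d) 0 j ^+ 2.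
  rewrite -(pair_bigA _ (fun i j => eucl_entry z (i, j) ^+ 2))/= big_ord1.
  by [].
congr Num.sqrt; rewrite !row.
rewrite -(pair_bigA _ (fun i j => eucl_entry (tensor x y) (i, j) ^+ 2))/=.
rewrite mulr_suml; apply: eq_bigr => i _.
by rewrite mulr_sumr; apply: eq_bigr => j _; rewrite /eucl_entry/= mxE exprMn.
Qed.

Context (E : finNormedModType R).

Lemma lfun_norm_le m n (f : 'Hom(euclid R m n, E)) v : `|f v| <= `|f| * `|v|.
Proof. exact: opnorm_le. Qed.

Lemma lfun_norm_ub m n (f : 'Hom(euclid R m n, E)) (M : R) : 0 <= M ->
  (forall v, `|f v| <= M * `|v|) -> `|f| <= M.
Proof.
move=> M0 fM; rewrite lfun_normE; apply: ge_sup.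
  by exists `|f 0|, 0 => //=; rewrite normr0.
move=> _ [v /= v1 <-]; rewrite (le_trans (fM v))//.
by rewrite ler_piMr.
Qed.

Lemma norm_curry_tensor (A : 'Hom(euclid R d d, E)) x : `|curry_tensor A x| <= `|A| * `|x|.
Proof.
apply: lfun_norm_ub => [|y]; first by rewrite mulr_ge0.
rewrite curry_tensorE (le_trans (lfun_norm_le _ _))//.
by rewrite norm_tensor mulrA.
Qed.

Lemma curry_tensorB (A B : 'Hom(euclid R d d, E)) x :
  curry_tensor (A - B) x = curry_tensor A x - curry_tensor B x.
Proof.
by apply/lfunP => y; rewrite add_lfunE opp_lfunE !curry_tensorE add_lfunE opp_lfunE.
Qed.

Lemma curry_tensorBr (A : 'Hom(euclid R d d, E)) x x' :
  curry_tensor A (x - x') = curry_tensor A x - curry_tensor A x'.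
Proof.
apply/lfunP => y; rewrite add_lfunE opp_lfunE !curry_tensorE.
by rewrite tensorDl tensorNl linearB.
Qed.

(** Bilinear and bounded, hence jointly continuous. *)
Lemma cvg_curry_tensor (F : set_system R) (FF : Filter F)
    (A : R -> 'Hom(euclid R d d, E)) (x : R -> euclid R 1 d)
    (A0 : 'Hom(euclid R d d, E)) (x0 : euclid R 1 d) :
  A @ F --> A0 -> x @ F --> x0 ->
  (fun r => curry_tensor (A r) (x r)) @ F --> curry_tensor A0 x0.
Proof.
move=> AA0 xx0; apply/cvgrPdist_le => e e0.
pose M := `|x0| + 1 + `|A0|.
have M0 : 0 < M by rewrite /M ltr_pwDl// ltr_wpDl.
pose dl := Num.min 1 (e / M).
have dl0 : 0 < dl by rewrite lt_min ltr01 divr_gt0.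
have dlM : dl * M <= e by rewrite -ler_pdivlMr// /dl ge_min lexx orbT.
have /cvgrPdist_le/(_ dl dl0) := AA0; have /cvgrPdist_le/(_ dl dl0) := xx0.
apply: filterS2 => r xr Ar.
have -> : curry_tensor A0 x0 - curry_tensor (A r) (x r) =
    curry_tensor (A0 - A r) (x r) + curry_tensor A0 (x0 - x r).
  by rewrite curry_tensorB curry_tensorBr [RHS]addrC addrA subrK.
have xr1 : `|x r| <= `|x0| + 1.
  rewrite -[x r](subrK x0) addrC (le_trans (ler_normD _ _))// lerD2l distrC.
  by rewrite (le_trans xr)// /dl ge_min lexx.
rewrite (le_trans (ler_normD _ _))// (le_trans _ dlM)// /M mulrDr lerD//.
  rewrite (le_trans (norm_curry_tensor _ _))//.
  by rewrite ler_pM.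
by rewrite (le_trans (norm_curry_tensor _ _))// mulrC ler_wpM2r.
Qed.

End operator_norms.

Section germs.
Context (R : realType) (d : nat) (E : finNormedModType R).
Implicit Types (X : R -> euclid R 1 d) (XX : R -> R -> euclid R d d)
  (Y : R -> 'Hom(euclid R 1 d, E)) (DY : R -> 'Hom(euclid R d d, E)).

(** Both germs obey the same computation: the second-order process [XX] satisfies
    a Chen relation whose left factor [xi] is [X] for [germ], and the left-limit
    path of [X] for [germ_left]. *)
Lemma defect_germ X xi XX Y DY a b c :
  XX a c - XX a b - XX b c = tensor (incr xi a b) (incr X b c) ->
  defect (germ X XX Y DY) a b c =
  - ((incr Y a b - curry_tensor (DY a) (incr xi a b)) (incr X b c)
     + incr DY a b (XX b c)).
Proof.
move=> chen; have XXac : XX a c = XX a b + XX b c + tensor (incr xi a b) (incr X b c).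
  by rewrite -chen; apply/matrixP => i j; rewrite !mxE; ring.
have Xac : incr X a c = incr X a b + incr X b c.
  by apply/matrixP => i j; rewrite !mxE; ring.
rewrite /defect /germ XXac Xac /(incr Y) /(incr DY) !add_lfunE !opp_lfunE.
move: (incr X a b) (incr X b c) (incr xi a b) => u v xi_ab.
rewrite !linearD/= curry_tensorE.
move: (Y a u) (Y a v) (Y b v) (DY a _) (DY a _) (DY a _) (DY b _) => e1 e2 e3 e4 e5 e6 e7.
rewrite !opprK !addrA.
by rewrite [LHS](ACl ((1*6)*(3*7)*8*2*5*9*4))/= !subrr !add0r.
Qed.

(** Adding the jump at the base point moves the left factor of Chen's relation to
    the left limits. *)
Lemma chen_tilde X XX a b c :
  XX a c - XX a b - XX b c = tensor (incr X a b) (incr X b c) ->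
  XXtilde X XX a c - XXtilde X XX a b - XXtilde X XX b c =
  tensor (incr (leftlim X) a b) (incr X b c).
Proof.
move=> chen; have XXac : XX a c = XX a b + XX b c + tensor (incr X a b) (incr X b c).
  by rewrite -chen; apply/matrixP => i j; rewrite !mxE; ring.
rewrite /XXtilde XXac /jump /incr.
move: (leftlim X a) (leftlim X b) (X a) (X b) (X c) (XX a b) (XX b c) => la lb xa xb xc m n.
by apply/matrixP => i j; rewrite !mxE; ring.
Qed.

(** The coefficient of [X s t] in the difference of the two germs at [s]; it
    is the limit of [remainder r s] as [r] increases to [s]. *)
Definition remainder_jump X Y DY x : 'Hom(euclid R 1 d, E) :=
  jump Y x - curry_tensor (leftlim DY x) (jump X x).

Lemma germ_sub_germ_left X XX Y DY a b :
  germ X XX Y DY a b - germ_left X XX Y DY a b =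
  remainder_jump X Y DY a (incr X a b) + jump DY a (XX a b).
Proof.
rewrite /germ /germ_left /remainder_jump /XXtilde.
move: (incr X a b) (jump X a) => u v.
rewrite /jump [leftlim DY a (_ + _)]linearD/= !add_lfunE !opp_lfunE curry_tensorE.
move: (Y a _) (leftlim Y a _) (DY a _) (leftlim DY a _) (leftlim DY a _) => e1 e2 e3 e4 e5.
by rewrite !opprD !addrA [LHS](ACl (1*3*5*2*4))/=.
Qed.


End germs.

(** * Variation *)

Section variation.
Context (R : realType) (V : normedModType R).
Implicit Types (W : R -> R -> V) (q s t T : R).

Definition power_sum q W s P : R := \sum_(c <- cells s P) `|W c.1 c.2| `^ q.

Lemma power_sum_ge0 q W s P : 0 <= power_sum q W s P.
Proof. by apply: sumr_ge0 => c _; exact: powR_ge0. Qed.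

Lemma power_sum_le_variation q W s t P : 0 < q -> itv_partition s t P ->
  ((power_sum q W s P `^ q^-1)%:E <= variation_norm q W s t)%E.
Proof.
move=> q0 sP; rewrite -poweR_EFin /variation_norm.
set S := [set _ | _ in _]%classic.
have SP : ((power_sum q W s P)%:E <= ereal_sup S)%E by apply: ereal_sup_ubound; exists P.
apply: gt0_ler_poweR => //; first by rewrite invr_ge0 ltW.
  by rewrite in_itv/= lee_fin power_sum_ge0 leey.
by rewrite in_itv/= (le_trans _ SP) ?lee_fin ?power_sum_ge0// leey.
Qed.

Lemma variation_norm_bounded q W s t : 0 < q -> (variation_norm q W s t < +oo)%E ->
  exists2 M : R, 0 <= M & forall P, itv_partition s t P -> power_sum q W s P <= M.
Proof.
move=> q0 fin; exists (fine (variation_norm q W s t) `^ q); first exact: powR_ge0.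
move=> P sP; have le := power_sum_le_variation W q0 sP.
have fin_num : variation_norm q W s t \is a fin_num.
  by rewrite ge0_fin_numE// /variation_norm poweR_ge0.
rewrite -[leLHS](powRr1 (power_sum_ge0 _ _ _ _)) -[X in _ `^ X <= _](mulVf (lt0r_neq0 q0)).
rewrite powRrM ge0_ler_powR ?nnegrE ?powR_ge0 ?(ltW q0)//.
  by rewrite fine_ge0// /variation_norm poweR_ge0.
by rewrite -lee_fin fineK.
Qed.

(** Completing a partition of a subinterval by the end points of [0, T] only adds
    cells, so the variation over [0, T] controls it. *)
Lemma extend_itv_partition T s t P : itv_partition s t P -> 0 <= s -> t <= T ->
  exists2 Q, itv_partition 0 T Q & forall F : R * R -> R, (forall c, 0 <= F c) ->
    \sum_(c <- cells s P) F c <= \sum_(c <- cells 0 Q) F c.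
Proof.
move=> sP s0 tT.
pose Q1 := if s == 0 then [::] else [:: s].
pose Q2 := if t == T then [::] else [:: T].
have sQ1 : itv_partition 0 s Q1.
  rewrite /Q1; have [->//|sn0] := eqVneq s 0.
  by apply: itv_partition1; rewrite lt_neqAle eq_sym sn0.
have tQ2 : itv_partition t T Q2.
  rewrite /Q2; have [->//|tnT] := eqVneq t T.
  by apply: itv_partition1; rewrite lt_neqAle tnT.
exists (Q1 ++ P ++ Q2).
  exact: itv_partition_cat sQ1 (itv_partition_cat sP tQ2).
move=> F F0; rewrite !cells_cat !big_cat/=.
have -> : last 0 Q1 = s by have [_ /eqP] := sQ1.
rewrite addrCA lerDl addr_ge0// sumr_ge0//.
Qed.

Lemma power_sum_sub q W T M s t P :
  (forall Q, itv_partition 0 T Q -> power_sum q W 0 Q <= M) ->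
  itv_partition s t P -> 0 <= s -> t <= T -> power_sum q W s P <= M.
Proof.
move=> WM sP s0 tT; have [Q TQ] := extend_itv_partition sP s0 tT.
move=> /(_ (fun c => `|W c.1 c.2| `^ q) (fun=> powR_ge0 _ _)) /le_trans; apply.
exact: WM.
Qed.

Lemma norm_le_power_sum q W T M a b : 0 < q ->
  (forall Q, itv_partition 0 T Q -> power_sum q W 0 Q <= M) ->
  0 <= a -> a < b -> b <= T -> `|W a b| <= M `^ q^-1.
Proof.
move=> q0 WM a0 ab bT.
have := power_sum_sub WM (itv_partition1 ab) a0 bT.
rewrite /power_sum/cells/= big_seq1/= => le.
rewrite -[leLHS](powRr1 (normr_ge0 _)) -[X in _ `^ X <= _](mulfV (lt0r_neq0 q0)) powRrM.
by rewrite ge0_ler_powR ?nnegrE ?powR_ge0 ?invr_ge0 ?(ltW q0)// (le_trans _ le) ?powR_ge0.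
Qed.

(** When [J x] is a left limit of values [W y x], each point [x] of a partition has
    a left neighbour [y], after the preceding point, with [W y x] comparable to
    [J x]. Inserting these neighbours gives a partition with the cells (y, x). *)
Lemma sum_jumps_le (V' : normedModType R) (J : R -> V') q W T M s t P : 0 < q ->
  (forall Q, itv_partition 0 T Q -> power_sum q W 0 Q <= M) ->
  J 0 = 0 ->
  (forall a x, 0 <= a -> a < x -> x <= T ->
     exists y, [/\ a < y, y < x & `|J x| <= 2 * `|W y x|]) ->
  itv_partition s t P -> 0 <= s -> t <= T ->
  \sum_(c <- cells s P) `|J c.1| `^ q <= 2 `^ q * M.
Proof.
move=> q0 WM J0 Japprox sP s0 tT.
have along l a : 0 <= a -> path <%R a l -> last a l <= T ->
    exists2 Q, itv_partition a (last a l) Q &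
      \sum_(x <- l) `|J x| `^ q <= 2 `^ q * power_sum q W a Q.
  elim: l a => [a _ _ _|x l IH a a0 /= /andP[ax xl] lT].
    by exists [::] => //; rewrite /power_sum !big_nil mulr0.
  have x0 : 0 <= x by rewrite (le_trans a0) ?ltW.
  have [Q xQ leQ] := IH x x0 xl lT.
  have xT : x <= T by exact: le_trans (itv_partition_le xQ) lT.
  have [y [ay yx Jy]] := Japprox a x a0 ax xT.
  exists (y :: x :: Q).
    by case: xQ => pQ lQ; split => //=; rewrite ay yx.
  rewrite big_cons /power_sum !cells_cons !big_cons/= !mulrDr.
  rewrite ler_wpDl ?mulr_ge0 ?powR_ge0// lerD// -powRM//.
  by rewrite ge0_ler_powR ?nnegrE ?mulr_ge0 ?(ltW q0).
have to_T l : path <%R 0 l -> last 0 l <= T -> \sum_(x <- l) `|J x| `^ q <= 2 `^ q * M.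
  move=> l0 lT; have [Q lQ leQ] := along l 0 (lexx 0) l0 lT.
  rewrite (le_trans leQ)// ler_wpM2l ?powR_ge0//.
  exact: power_sum_sub WM lQ (lexx 0) lT.
have cells_fst : \sum_(c <- cells s P) `|J c.1| `^ q <= \sum_(x <- s :: P) `|J x| `^ q.
  elim: P s {sP s0} => [|x P IH] s; first by rewrite big_nil sumr_ge0// => *; exact: powR_ge0.
  by rewrite cells_cons big_cons [leRHS]big_cons lerD2l; exact: IH.
apply: (le_trans cells_fst).
have [pP /eqP lP] := sP.
have [s_eq0|sn0] := eqVneq s 0.
  rewrite big_cons s_eq0 J0 normr0 powR0 ?gt_eqF// add0r.
  by apply: to_T; rewrite -s_eq0// lP.
by apply: to_T; rewrite /= ?lP// pP lt_neqAle eq_sym sn0 s0.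
Qed.

End variation.

Section young.
Context (R : realType).

Lemma sum_triples_powR_le s P (V1 V2 : normedModType R)
    (F : R -> R -> V1) (G : R -> R -> V2) (u v w : R) : 0 < u -> 0 < v ->
  w^-1 = u^-1 + v^-1 ->
  \sum_(tr <- triples s P) (`|F tr.1.1 tr.1.2| * `|G tr.1.2 tr.2|) `^ w <=
  2 * (power_sum u F s P `^ u^-1 * power_sum v G s P `^ v^-1) `^ w.
Proof.
move=> u0 v0 ww; apply: (sum_powR_mul_le _ _ _ _ u0 v0 ww) => //; rewrite ?powR_ge0//.
  rewrite -powRrM mulVf ?gt_eqF// powRr1 ?power_sum_ge0//.
  exact: (sum_triples_fst s P (fun c => powR_ge0 `|F c.1 c.2| u)).
rewrite -powRrM mulVf ?gt_eqF// powRr1 ?power_sum_ge0//.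
exact: (sum_triples_snd s P (fun c => powR_ge0 `|G c.1 c.2| v)).
Qed.

Context (V V1 V2 V3 V4 : normedModType R) (Xi : R -> R -> V)
  (F : R -> R -> V1) (G : R -> R -> V2) (F' : R -> R -> V3) (G' : R -> R -> V4).
Context (u v w s t : R).
Hypotheses (u0 : 0 < u) (v0 : 0 < v) (w01 : 0 < w < 1) (ww : w^-1 = u^-1 + v^-1).
Hypothesis defect_le : forall a b c, s <= a -> a < b -> b < c -> c <= t ->
  `|defect Xi a b c| <= `|F a b| * `|G b c| + `|F' a b| * `|G' b c|.

(** The first factor of a defect lives on the first cell of a triple and the second
    one on the second cell, so both are summed along the partition itself. *)
Lemma sum_defect_powR_le P : itv_partition s t P ->
  \sum_(tr <- triples s P) `|defect Xi tr.1.1 tr.1.2 tr.2| `^ w <=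
  8 * (power_sum u F s P `^ u^-1 * power_sum v G s P `^ v^-1 +
       power_sum v F' s P `^ v^-1 * power_sum u G' s P `^ u^-1) `^ w.
Proof.
move=> sP; have /andP[w0 w1] := w01.
have merge (A B : R) : 0 <= A -> 0 <= B ->
    2 * (2 * A `^ w + 2 * B `^ w) <= 8 * (A + B) `^ w.
  move=> A0 B0; have AB : A `^ w <= (A + B) `^ w.
    by apply: ge0_ler_powR; rewrite ?nnegrE ?addr_ge0 ?(ltW w0) ?lerDl.
  have BA : B `^ w <= (A + B) `^ w.
    by apply: ge0_ler_powR; rewrite ?nnegrE ?addr_ge0 ?(ltW w0) ?lerDr.
  by move: AB BA; move: (_ `^ w) (_ `^ w) (_ `^ w) => x y z; lra.
have ww' : w^-1 = v^-1 + u^-1 by rewrite addrC.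
apply: le_trans (merge _ _ (mulr_ge0 (powR_ge0 _ _) (powR_ge0 _ _))
  (mulr_ge0 (powR_ge0 _ _) (powR_ge0 _ _))).
apply: le_trans (ler_wpM2l _ (lerD (sum_triples_powR_le s P F G u0 v0 ww)
  (sum_triples_powR_le s P F' G' v0 u0 ww'))) => //.
rewrite -big_split mulr_sumr/= big_seq [leRHS]big_seq ler_sum// => -[[a b] c] /= trP.
have [abP bcP] := triples_cells trP.
have [/andP[sa ab] _ _ _ _] := cells_itv_partition sP abP.
have [/andP[_ bc] ct _ _ _] := cells_itv_partition sP bcP.
have w01' : 0 < w <= 1 by rewrite w0 ltW.
apply: le_trans (powRD_le (mulr_ge0 (normr_ge0 _) (normr_ge0 _))
  (mulr_ge0 (normr_ge0 _) (normr_ge0 _)) w01').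
by rewrite ge0_ler_powR ?nnegrE ?addr_ge0 ?mulr_ge0 ?(ltW w0)// defect_le.
Qed.

End young.

Section estimate.
Context (R : realType).

(** Compare every Riemann sum with the one-cell partition [:: t] and let the
    partition become finer. Power sums over one partition are real numbers; they
    are compared with the variation norms in the extended reals, where an infinite
    norm times a vanishing one is zero, as is the corresponding product of sums. *)
Lemma young_estimate (w : R) : 0 < w < 1 -> exists2 C : R, 0 < C &
  forall (V V1 V2 V3 V4 : normedModType R) (Xi : R -> R -> V)
    (F : R -> R -> V1) (G : R -> R -> V2) (F' : R -> R -> V3) (G' : R -> R -> V4)
    (u v s t : R) (I : V),
  0 < u -> 0 < v -> w^-1 = u^-1 + v^-1 ->
  (forall a b c, s <= a -> a < b -> b < c -> c <= t ->
     `|defect Xi a b c| <= `|F a b| * `|G b c| + `|F' a b| * `|G' b c|) ->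
  Xi s s = 0 -> s <= t -> rrs_lim (riemann_sum Xi s) s t I ->
  (`|I - Xi s t|%:E <= C%:E *
    (variation_norm u F s t * variation_norm v G s t +
     variation_norm v F' s t * variation_norm u G' s t))%E.
Proof.
move=> w01; have /andP[w0 w1] := w01; have [K K0 removal] := removal_bound w01.
exists (K * 8 `^ w^-1) => [|V V1 V2 V3 V4 Xi F G F' G' u v s t I u0 v0 ww defect_le Xi0 st SI].
  by rewrite mulr_gt0 ?powR_gt0.
have C0 : 0 < K * 8 `^ w^-1 by rewrite mulr_gt0 ?powR_gt0.
set S := (_ * _ + _ * _)%E.
have S0 : (0 <= S)%E by rewrite adde_ge0// mule_ge0// /variation_norm poweR_ge0.
have [Sfin|] := boolP (S \is a fin_num); last first.
  by rewrite ge0_fin_numE// -leNgt leye_eq => /eqP ->; rewrite gt0_muley ?lte_fin// leey.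
rewrite -[S]fineK// -EFinM lee_fin.
apply: (rrs_lim_le SI) => P sP.
have m0 : 0 <= fine S by exact: fine_ge0.
have [s_eq_t|s_neq_t] := eqVneq s t.
  have -> : P = [::] by move: sP; rewrite -s_eq_t => /itv_partitionxx.
  by rewrite -s_eq_t Xi0 /riemann_sum big_nil subr0 normr0 mulr_ge0 // ltW.
have s_lt_t : s < t by rewrite lt_neqAle s_neq_t.
have -> : Xi s t = riemann_sum Xi s [:: t] by rewrite /riemann_sum/= big_seq1.
have -> : K * 8 `^ w^-1 * fine S = K * (8 * fine S `^ w) `^ w^-1.
  by rewrite powRM ?powR_ge0// -powRrM mulfV ?gt_eqF// powRr1// mulrA.
apply: (removal _ _ s t) => //; first exact: itv_partition1.
- move=> Q sQ _; apply: (@le_trans _ _ (\sum_(tr <- triples s Q)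
      `|defect Xi tr.1.1 tr.1.2 tr.2| `^ w)).
    by rewrite big_mkcond ler_sum// => tr _; case: ifP => // _; exact: powR_ge0.
  apply: (le_trans (sum_defect_powR_le u0 v0 w01 ww defect_le sQ)).
  apply: ler_wpM2l => //; apply: ge0_ler_powR; [exact: ltW| |by []|].
    by apply: addr_ge0; apply: mulr_ge0; exact: powR_ge0.
  rewrite -lee_fin (fineK Sfin) EFinD.
  by apply: leeD; rewrite EFinM; apply: lee_pmul;
    rewrite ?lee_fin ?powR_ge0//; exact: power_sum_le_variation.
- by move=> x; rewrite inE => /eqP ->; exact: mem_itv_partition_last sP.
Qed.

Lemma cells_unseparated (L : seq R) s t P a b : itv_partition s t P ->
  (forall x, x \in L -> s < x <= t -> x \in P) ->
  (a, b) \in cells s P -> b \notin L -> unseparated L a b.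
Proof.
move=> sP LP abP bL x xL.
have [/andP[sa ab] bt _ _ sep] := cells_itv_partition sP abP.
have [xs|sx] := leP x s; first by left; exact: le_trans sa.
have [xt|tx] := leP x t; last by right; exact: le_lt_trans tx.
have xP : x \in P by apply: LP => //; rewrite sx.
have [xa|bx] := sep x xP; [by left|right].
by rewrite lt_neqAle bx andbT; apply: contraNneq bL => ->.
Qed.

Lemma exists_unseparated_left (L : seq R) s a : s < a -> a \notin L ->
  exists a0, [/\ s <= a0, a0 < a & unseparated L a0 a].
Proof.
move=> sa; elim: L => [_|x L IH]; first by exists s.
rewrite inE negb_or => /andP[ax /IH[a0 [sa0 a0a sep]]].
have [xa|xa] := ltP x a; last first.
  exists a0; split=> // y; rewrite inE => /orP[/eqP->|/sep//].
  by right; rewrite lt_neqAle ax.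
exists (Num.max a0 x); split; rewrite ?le_max ?sa0// ?gt_max ?a0a//.
move=> y; rewrite inE => /orP[/eqP->|/sep[ya0|]]; last by right.
  by left; rewrite le_max lexx orbT.
by left; rewrite le_max ya0.
Qed.

(** Adding the midpoints of [s :: L] to [L] makes sure that no cell has both ends
    in [s :: L]. *)
Lemma midpoint_refinement (L : seq R) s t : s <= t ->
  exists2 P0, itv_partition s t P0 &
  forall P a b, itv_partition s t P -> {subset P0 <= P} -> (a, b) \in cells s P ->
    unseparated L a b \/ exists a0, [/\ s <= a0, a0 < a & unseparated L a0 a].
Proof.
move=> st; pose mids := [seq (x + y) / 2 | x <- s :: L, y <- L].
exists (part_through s t (L ++ mids)); first exact: part_throughP.
move=> P a b sP sub abP.
have inP x : x \in L ++ mids -> s < x <= t -> x \in P.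
  by move=> xL xst; apply: sub; rewrite mem_part_through inE xL orbT.
have [bL|bL] := boolP (b \in L); last first.
  by left; apply: (cells_unseparated sP) => // x xL; apply: inP; rewrite mem_cat xL.
have [/andP[sa ab] bt aP _ sep] := cells_itv_partition sP abP.
have [asL|] := boolP (a \in s :: L).
  have /sep : (a + b) / 2 \in P.
    apply: inP; last by apply/andP; split; lra.
    by rewrite mem_cat; apply/orP; right; exact: allpairs_f.
  by move=> mid; exfalso; case: mid => ?; lra.
rewrite inE negb_or => /andP[an_s aL]; right.
by apply: exists_unseparated_left aL; rewrite lt_neqAle eq_sym an_s.
Qed.

End estimate.

(** * The rough integral *)

Section rough_integral.
Context (R : realType) (p T : R) (d : nat) (E : finNormedModType R).
Context (X : R -> euclid R 1 d) (XX : R -> R -> euclid R d d)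
  (Y : R -> 'Hom(euclid R 1 d, E)) (DY : R -> 'Hom(euclid R d d, E)).
Hypotheses (p23 : 2 <= p < 3) (T0 : 0 <= T).
Hypotheses (rough : rough_path p T X XX) (controlled : controlled_path p T X Y DY).

Let p0 : 0 < p. Proof. by have /andP[] := p23; lra. Qed.

Let p20 : 0 < p / 2. Proof. by rewrite divr_gt0. Qed.

Let p3_lt1 : 0 < p / 3 < 1. Proof. by have /andP[] := p23; lra. Qed.

Let young_exponent : (p / 3)^-1 = (p / 2)^-1 + p^-1.
Proof. by field; rewrite gt_eqF. Qed.

Lemma rough_path_chen a b c : 0 <= a -> a <= b -> b <= c -> c <= T ->
  XX a c - XX a b - XX b c = tensor (incr X a b) (incr X b c).
Proof. by have [chenX _ _] := rough; exact: chenX. Qed.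

Lemma rough_path_cadlag : cadlag T X /\ cadlag T (XX 0).
Proof.
have [_ [cadr cadl] _] := rough.
have XE : X = fun t => incr X 0 t + X 0 by apply/funext => t; rewrite /incr subrK.
have left_limit t : 0 < t <= T -> exists l : euclid R 1 d * euclid R d d,
    (fun t => (incr X 0 t, XX 0 t)) @ t^'- --> l by move=> /cadl/cvg_ex.
split; split=> t tT.
- rewrite XE; apply: cvgD; last exact: cvg_cst.
  exact: (cvg_comp _ _ (cadr t tT) (@cvg_fst _ _ _ _ _)).
- have [l hl] := left_limit t tT; apply/cvg_ex; exists (l.1 + X 0).
  suff : (fun t => incr X 0 t + X 0) @ t^'- --> l.1 + X 0 by rewrite -XE.
  apply: cvgD; last exact: cvg_cst.
  exact: (cvg_comp _ _ hl (@cvg_fst _ _ _ _ _)).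
- exact: (cvg_comp _ _ (cadr t tT) (@cvg_snd _ _ _ _ _)).
- have [l hl] := left_limit t tT; apply/cvg_ex; exists l.2.
  exact: (cvg_comp _ _ hl (@cvg_snd _ _ _ _ _)).
Qed.

Lemma rough_path_bounded :
  (exists2 M : R, 0 <= M & forall Q, itv_partition 0 T Q -> power_sum p (incr X) 0 Q <= M) /\
  (exists2 M : R, 0 <= M & forall Q, itv_partition 0 T Q -> power_sum (p / 2) XX 0 Q <= M).
Proof.
have [_ _ fin] := rough.
have sqrt_ge0 : (0 <= variation_norm (p / 2) XX 0 T `^ 2^-1)%E by exact: poweR_ge0.
have var_ge0 : (0 <= variation_norm p (incr X) 0 T)%E by exact: poweR_ge0.
split; apply: variation_norm_bounded => //.
  by apply: le_lt_trans fin; rewrite leeDl.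
apply: (@lty_poweRy _ _ (2^-1)) => //.
by apply: le_lt_trans fin; rewrite leeDr.
Qed.

Lemma controlled_path_bounded :
  (exists2 M : R, 0 <= M & forall Q, itv_partition 0 T Q -> power_sum p (incr DY) 0 Q <= M) /\
  (exists2 M : R, 0 <= M & forall Q, itv_partition 0 T Q ->
     power_sum (p / 2) (remainder X Y DY) 0 Q <= M).
Proof.
have [_ _ _ finDY finR] := controlled.
by split; exact: variation_norm_bounded.
Qed.

Lemma XX_diag a : 0 <= a <= T -> XX a a = 0.
Proof.
move=> /andP[a0 aT]; have := rough_path_chen a0 (lexx a) (lexx a) aT.
have -> : incr X a a = 0 by rewrite /incr subrr.
by rewrite tensor0r subrr sub0r => /eqP; rewrite oppr_eq0 => /eqP.
Qed.

Lemma remainder_cvg_jump x : 0 < x -> x <= T ->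
  (fun r => remainder X Y DY r x) @ x^'- --> remainder_jump X Y DY x.
Proof.
move=> x0 xT; have [Yc DYc _ _ _] := controlled; have [Xc _] := rough_path_cadlag.
apply: cvgB; first exact: incr_cvg_jump Yc x0 xT.
by apply: cvg_curry_tensor; [exact: leftlim_cvg DYc x0 xT|exact: incr_cvg_jump Xc x0 xT].
Qed.

Lemma remainder_jump0 : remainder_jump X Y DY 0 = 0.
Proof.
rewrite /remainder_jump !jump0; apply/eqP; rewrite sub0r oppr_eq0; apply/eqP.
by have := curry_tensorBr (leftlim DY 0) 0 0; rewrite !subrr.
Qed.

(** Jumps and left limits are at most twice a nearby increment or value. *)
Lemma uniform_bound : exists2 B : R, 1 <= B &
  (forall a b, 0 <= a -> a < b -> b <= T ->
     [/\ `|incr X a b| <= B, `|XX a b| <= B, `|remainder X Y DY a b| <= B &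
         `|incr DY a b| <= B]) /\
  (forall a, 0 <= a -> a <= T ->
     [/\ `|DY a| <= B, `|leftlim DY a| <= B, `|jump DY a| <= B &
         `|remainder_jump X Y DY a| <= B]).
Proof.
have [[mX mX0 HX] [mXX mXX0 HXX]] := rough_path_bounded.
have [[mD mD0 HD] [mR mR0 HR]] := controlled_path_bounded.
have bX a b := @norm_le_power_sum _ _ p (incr X) T mX a b p0 HX.
have bXX a b := @norm_le_power_sum _ _ (p / 2) XX T mXX a b p20 HXX.
have bD a b := @norm_le_power_sum _ _ p (incr DY) T mD a b p0 HD.
have bR a b := @norm_le_power_sum _ _ (p / 2) (remainder X Y DY) T mR a b p20 HR.
have := powR_ge0 mX p^-1; have := powR_ge0 mXX (p / 2)^-1.
have := powR_ge0 mD p^-1; have := powR_ge0 mR (p / 2)^-1.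
move: (mX `^ _) (mXX `^ _) (mD `^ _) (mR `^ _) bX bXX bD bR.
move=> kX kXX kD kR bX bXX bD bR kR0 kD0 kXX0 kX0.
have DY0 := normr_ge0 (DY 0).
have [Yc DYc _ _ _] := controlled.
have bDY a : 0 <= a -> a <= T -> `|DY a| <= `|DY 0| + kD.
  rewrite le_eqVlt => /orP[/eqP <- _|a0 aT]; first by rewrite lerDl.
  rewrite -[in leLHS](subrK (DY 0) (DY a)) addrC (le_trans (ler_normD _ _))//.
  by rewrite lerD2l; exact: bD.
exists (1 + 2 * (kX + kXX + kD + kR + `|DY 0|)); first by lra.
split=> [a b a0 ab bT|a a0 aT].
  have := bX a b a0 ab bT; have := bXX a b a0 ab bT.
  have := bD a b a0 ab bT; have := bR a b a0 ab bT.
  by split; lra.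
have := bDY a a0 aT.
have [<- _|a_neq0] := eqVneq 0 a.
  by rewrite /leftlim eqxx jump0 remainder_jump0 !normr0; split; lra.
have a_gt0 : 0 < a by rewrite lt_neqAle a_neq0.
have [y1 [y10 y1a]] := left_lim_le_value (leftlim_cvg DYc a_gt0 aT) a_gt0.
have := bDY y1 (ltW y10) (le_trans (ltW y1a) aT).
have [y2 [y20 y2a]] := left_lim_le_value (incr_cvg_jump DYc a_gt0 aT) a_gt0.
have := bD y2 a (ltW y20) y2a aT.
have [y3 [y30 y3a]] := left_lim_le_value (remainder_cvg_jump a_gt0 aT) a_gt0.
have := bR y3 a (ltW y30) y3a aT.
by split; lra.
Qed.

Lemma defect_germ_le a b c : 0 <= a -> a <= b -> b <= c -> c <= T ->
  `|defect (germ X XX Y DY) a b c| <=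
  `|remainder X Y DY a b| * `|incr X b c| + `|incr DY a b| * `|XX b c|.
Proof.
move=> a0 ab bc cT; rewrite (defect_germ _ _ (rough_path_chen a0 ab bc cT)) normrN.
by rewrite (le_trans (ler_normD _ _))// lerD// lfun_norm_le.
Qed.

Lemma defect_germ_left_le a b c : 0 <= a -> a <= b -> b <= c -> c <= T ->
  `|defect (germ_left X XX Y DY) a b c| <=
  `|remainder_tilde X Y DY a b| * `|incr X b c| +
  `|incr (leftlim DY) a b| * `|XXtilde X XX b c|.
Proof.
move=> a0 ab bc cT.
rewrite (defect_germ (leftlim Y) (leftlim DY) (chen_tilde (rough_path_chen a0 ab bc cT))).
by rewrite normrN (le_trans (ler_normD _ _))// lerD// lfun_norm_le.
Qed.

Section on_interval.
Context (s t : R).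
Hypotheses (s0 : 0 <= s) (st : s <= t) (tT : t <= T).

(** Chen's relation turns the oscillation of the path [XX 0] into a bound on [XX]. *)
Lemma isolate_oscillation (B eta : R) :
  (forall a b, 0 <= a -> a < b -> b <= T -> `|incr X a b| <= B) -> 0 < eta ->
  exists L : seq R, forall a b, s <= a -> a < b -> b <= t -> unseparated L a b ->
    [/\ `|incr X a b| <= eta, `|XX a b| <= (1 + B) * eta, `|incr Y a b| <= eta &
        `|incr DY a b| <= eta].
Proof.
move=> XB eta0; have [Yc DYc _ _ _] := controlled; have [Xc XXc] := rough_path_cadlag.
have [L1 osc1] := cadlag_isolate_oscillation Xc s0 st tT eta0.
have [L2 osc2] := cadlag_isolate_oscillation XXc s0 st tT eta0.
have [L3 osc3] := cadlag_isolate_oscillation Yc s0 st tT eta0.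
have [L4 osc4] := cadlag_isolate_oscillation DYc s0 st tT eta0.
exists (L1 ++ L2 ++ L3 ++ L4) => a b sa ab bt sep.
have sep1 : unseparated L1 a b by move=> x xL; apply: sep; rewrite !mem_cat xL.
have sep2 : unseparated L2 a b by move=> x xL; apply: sep; rewrite !mem_cat xL orbT.
have sep3 : unseparated L3 a b by move=> x xL; apply: sep; rewrite !mem_cat xL !orbT.
have sep4 : unseparated L4 a b by move=> x xL; apply: sep; rewrite !mem_cat xL !orbT.
have a0 : 0 <= a by exact: le_trans sa.
have bT : b <= T by exact: le_trans tT.
have Xab := osc1 a b sa (ltW ab) bt sep1.
have XXab := osc2 a b sa (ltW ab) bt sep2.
split; [by []| |exact: osc3 (ltW ab) _ _|exact: osc4 (ltW ab) _ _].
have -> : XX a b = incr (XX 0) a b - tensor (incr X 0 a) (incr X a b).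
  rewrite -(rough_path_chen (lexx 0) a0 (ltW ab) bT) /incr.
  by apply/matrixP => i j; rewrite !mxE; ring.
rewrite (le_trans (ler_normB _ _))// mulrDl mul1r lerD// norm_tensor.
have B0 : 0 <= B by rewrite (le_trans _ (XB a b _ _ _)).
rewrite ler_pM//; move: a0; rewrite le_eqVlt => /orP[/eqP <-|a0].
  by rewrite /incr subrr normr0.
by apply: XB => //; rewrite (le_trans _ bT)// ltW.
Qed.

(** At a point [b] outside the partition that isolates the oscillations of [X], [Y]
    and [DY], the factors [remainder X Y DY a b] and [incr DY a b] of the defect are
    small, whereas the other factors may contain a jump but stay bounded. *)
Lemma rrs_lim_germ : exists I, rrs_lim (riemann_sum (germ X XX Y DY) s) s t I.
Proof.
have [[mX mX0 HX] [mXX mXX0 HXX]] := rough_path_bounded.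
have [[mD mD0 HD] [mR mR0 HR]] := controlled_path_bounded.
have [B B1 [bound_incr bound_pt]] := uniform_bound.
have B0 : 0 <= B by lra.
pose W := 8 * (mR `^ (p / 2)^-1 * mX `^ p^-1 + mD `^ p^-1 * mXX `^ (p / 2)^-1) `^ (p / 3).
apply: (@sewing _ _ _ s t _ W p3_lt1 st) => [P sP|eta eta0].
  apply: (le_trans (sum_defect_powR_le (F := remainder X Y DY) (G := incr X)
    (F' := incr DY) (G' := XX) p20 p0 p3_lt1 young_exponent _ sP)).
    move=> a b c sa ab bc ct; apply: defect_germ_le; [|exact: ltW|exact: ltW|].
      exact: le_trans sa.
    exact: le_trans tT.
  have root_le (V : normedModType R) (F : R -> R -> V) q M : 0 < q ->
      (forall Q, itv_partition 0 T Q -> power_sum q F 0 Q <= M) ->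
      power_sum q F s P `^ q^-1 <= M `^ q^-1.
    move=> q0 FM; have le := power_sum_sub FM sP s0 tT.
    apply: ge0_ler_powR => //; rewrite ?invr_ge0 ?(ltW q0) ?nnegrE ?power_sum_ge0//.
    by rewrite (le_trans _ le) ?power_sum_ge0.
  have w0 : 0 <= p / 3 by have /andP[/ltW] := p3_lt1.
  rewrite /W; apply: ler_wpM2l; first exact: ler0n.
  have nneg (x y z u : R) (a b c e : R) : 0 <= x `^ a * y `^ b + z `^ c * u `^ e.
    by apply: addr_ge0; apply: mulr_ge0; exact: powR_ge0.
  apply: (ge0_ler_powR w0); [exact: nneg|exact: nneg|].
  apply: lerD; apply: ler_pM; (try exact: powR_ge0); apply: root_le => //.
(* [B * (2 + B)] collects the constants multiplying [eta'] at the end. *)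
pose eta' := eta / (B * (2 + B)).
have k0 : 0 < B * (2 + B) by rewrite mulr_gt0//; lra.
have eta'0 : 0 < eta' by rewrite divr_gt0.
have [|L osc] := @isolate_oscillation B eta' _ eta'0.
  by move=> a b a0 ab bT; have [] := bound_incr a b a0 ab bT.
exists (part_through s t L); first exact: part_throughP.
move=> P [[a b] c] sP sub trP /= bL.
have [abP bcP] := triples_cells trP.
have [/andP[sa ab] bt _ _ _] := cells_itv_partition sP abP.
have [/andP[_ bc] ct _ _ _] := cells_itv_partition sP bcP.
have a0 : 0 <= a by exact: le_trans sa.
have b0 : 0 <= b by exact: le_trans (ltW ab).
have aT : a <= T by exact: le_trans (ltW ab) (le_trans bt tT).
have cT : c <= T by exact: le_trans tT.
have sep : unseparated L a b.
  apply: (cells_unseparated sP) abP _.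
    by move=> x xL xst; apply: sub; rewrite mem_part_through inE xL orbT.
  apply: contra bL => bL; rewrite mem_part_through inE bL orbT bt andbT.
  exact: le_lt_trans ab.
have [Xab _ Yab Dab] := osc a b sa ab bt sep.
have [Xbc XXbc _ _] := bound_incr b c b0 bc cT.
have [Da _ _ _] := bound_pt a a0 aT.
have Rab : `|remainder X Y DY a b| <= (1 + B) * eta'.
  rewrite (le_trans (ler_normB _ _))// mulrDl mul1r lerD//.
  by rewrite (le_trans (norm_curry_tensor _ _))// ler_pM.
rewrite (le_trans (defect_germ_le a0 (ltW ab) (ltW bc) cT))//.
apply: (@le_trans _ _ ((1 + B) * eta' * B + eta' * B)).
  by apply: lerD; apply: ler_pM.
have -> : (1 + B) * eta' * B + eta' * B = eta' * (B * (2 + B)) by ring.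
by rewrite /eta' mulfVK// gt_eqF.
Qed.

(** The two germs differ at (a, b) by products of a jump at [a] with an increment
    over (a, b]. By [midpoint_refinement] one of the two factors is small in every
    cell: the increment if (a, b] avoids the points that isolate the oscillations,
    and otherwise the jump, [a] then being none of these points. *)
Lemma rrs_lim_germ_sub_germ_left :
  rrs_lim (riemann_sum (fun a b => germ X XX Y DY a b - germ_left X XX Y DY a b) s) s t 0.
Proof.
have [[mX mX0 HX] [mXX mXX0 HXX]] := rough_path_bounded.
have [[mD mD0 HD] [mR mR0 HR]] := controlled_path_bounded.
have [B B1 [bound_incr bound_pt]] := uniform_bound.
have B0 : 0 <= B by lra.
have [Yc DYc _ _ _] := controlled; have [Xc _] := rough_path_cadlag.
have sub_le a b : `|germ X XX Y DY a b - germ_left X XX Y DY a b| <=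
    `|remainder_jump X Y DY a| * `|incr X a b| + `|jump DY a| * `|XX a b|.
  rewrite germ_sub_germ_left (le_trans (ler_normD _ _))//.
  by rewrite lerD// lfun_norm_le.
pose W := 2 * ((2 `^ (p / 2) * mR + mX) + (2 `^ p * mD + mXX)).
apply: (@rrs_lim_null _ _ _ s t _ W p3_lt1 st) => [P sP|eta eta0].
  have sumR : \sum_(c <- cells s P) `|remainder_jump X Y DY c.1| `^ (p / 2) <= 2 `^ (p / 2) * mR.
    apply: (sum_jumps_le p20 HR remainder_jump0 _ sP s0 tT) => a x a0 ax xT.
    have x0 : 0 < x by exact: le_lt_trans ax.
    exact: left_lim_le_value (remainder_cvg_jump x0 xT) ax.
  have sumD : \sum_(c <- cells s P) `|jump DY c.1| `^ p <= 2 `^ p * mD.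
    apply: (sum_jumps_le p0 HD (jump0 _) _ sP s0 tT) => a x a0 ax xT.
    have x0 : 0 < x by exact: le_lt_trans ax.
    exact: left_lim_le_value (incr_cvg_jump DYc x0 xT) ax.
  have sumX := power_sum_sub HX sP s0 tT.
  have sumXX := power_sum_sub HXX sP s0 tT.
  apply: le_trans (ler_wpM2l _ (lerD (lerD sumR sumX) (lerD sumD sumXX))) => //.
  rewrite /power_sum -!big_split mulr_sumr/=; apply: ler_sum => -[a b] _ /=.
  have /andP[w0 /ltW w1] := p3_lt1.
  have w01 : 0 < p / 3 <= 1 by rewrite w0.
  have pos (u v : R) : 0 <= `|u| * `|v| by exact: mulr_ge0.
  apply: (@le_trans _ _ ((`|remainder_jump X Y DY a| * `|incr X a b| +
      `|jump DY a| * `|XX a b|) `^ (p / 3))).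
    by apply: ge0_ler_powR; rewrite ?(ltW w0)// nnegrE ?addr_ge0 ?pos.
  apply: (le_trans (powRD_le _ _ w01)); rewrite ?mulr_ge0// ler_wpM2l// lerD//.
    exact: (powR_mul_le_add _ _ p20 p0 young_exponent).
  by apply: (powR_mul_le_add _ _ p0 p20) => //; rewrite addrC young_exponent.
(* [B * (2 + B)] collects the constants multiplying [eta'] at the end. *)
pose eta' := eta / (B * (2 + B)).
have k0 : 0 < B * (2 + B) by rewrite mulr_gt0//; lra.
have eta'0 : 0 < eta' by rewrite divr_gt0.
have eta'E : eta' * (B * (2 + B)) = eta by rewrite /eta' mulfVK// gt_eqF.
have [|L osc] := @isolate_oscillation B eta' _ eta'0.
  by move=> a b a0 ab bT; have [] := bound_incr a b a0 ab bT.
have [P0 sP0 mid] := midpoint_refinement L st.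
exists P0 => // P [a b] sP sub abP /=.
have [/andP[sa ab] bt _ _ _] := cells_itv_partition sP abP.
have a0 : 0 <= a by exact: le_trans sa.
have aT : a <= T by exact: le_trans (ltW ab) (le_trans bt tT).
have bT : b <= T by exact: le_trans tT.
have [bX bXX _ _] := bound_incr a b a0 ab bT.
have [_ bDl bJD bJR] := bound_pt a a0 aT.
apply: (le_trans (sub_le a b)).
have [sep|[a1 [sa1 a1a sep]]] := mid P a b sP sub abP.
  have [Xab XXab _ _] := osc a b sa ab bt sep.
  rewrite -eta'E; apply: (@le_trans _ _ (B * eta' + B * ((1 + B) * eta'))).
    by apply: lerD; apply: ler_pM.
  by rewrite le_eqVlt; apply/orP; left; apply/eqP; ring.
have small y : a1 < y -> y < a -> [/\ `|incr X y a| <= eta', `|incr Y y a| <= eta' &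
    `|incr DY y a| <= eta'].
  move=> a1y ya; have [] := osc y a _ ya _ _ => //.
  - exact: le_trans sa1 (ltW a1y).
  - exact: le_trans (ltW ab) bt.
  - move=> x /sep[xa1|ax]; [left|by right].
    exact: le_trans xa1 (ltW a1y).
have a10 : 0 <= a1 by exact: le_trans sa1.
have jX : `|jump X a| <= eta'.
  by apply: (jump_le Xc a10 a1a aT) => y a1y ya; have [] := small y a1y ya.
have jY : `|jump Y a| <= eta'.
  by apply: (jump_le Yc a10 a1a aT) => y a1y ya; have [] := small y a1y ya.
have jD : `|jump DY a| <= eta'.
  by apply: (jump_le DYc a10 a1a aT) => y a1y ya; have [] := small y a1y ya.
have jR : `|remainder_jump X Y DY a| <= (1 + B) * eta'.
  rewrite (le_trans (ler_normB _ _))// mulrDl mul1r lerD//.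
  by rewrite (le_trans (norm_curry_tensor _ _))// ler_pM.
rewrite -eta'E; apply: (@le_trans _ _ ((1 + B) * eta' * B + eta' * B)).
  by apply: lerD; apply: ler_pM.
by rewrite le_eqVlt; apply/orP; left; apply/eqP; ring.
Qed.

Lemma exists_rough_integral : exists I, is_rough_integral X XX Y DY s t I.
Proof.
have [I SI] := rrs_lim_germ; exists I; split; last exact: SI.
have D0 := rrs_lim_germ_sub_germ_left.
apply/rrs_limP => //; move/(rrs_limP _ _ st): SI => SI; move/(rrs_limP _ _ st): D0 => D0.
have FF := refinement_filter_proper st.
rewrite -[I]subr0.
suff -> : sum_left X XX Y DY s = riemann_sum (germ X XX Y DY) s \-
    riemann_sum (fun a b => germ X XX Y DY a b - germ_left X XX Y DY a b) s.
  exact: cvgB.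
apply/funext => P; rewrite /= /riemann_sum -sumrB.
by apply: eq_bigr => c _; rewrite subKr.
Qed.

End on_interval.
End rough_integral.

Theorem theorem34 (R : realType) (p : R) (hp : 2 <= p < 3) :
  exists C : R,
  forall (T : R) (d : nat) (E : finNormedModType R)
    (X : R -> euclid R 1 d) (XX : R -> R -> euclid R d d)
    (Y : R -> 'Hom(euclid R 1 d, E)) (Y' : R -> 'Hom(euclid R d d, E)),
  0 <= T -> rough_path p T X XX -> controlled_path p T X Y Y' ->
  (exists I : E, is_rough_integral X XX Y Y' 0 T I) /\
  (forall s t : R, 0 <= s -> s <= t -> t <= T ->
    exists I : E,
    [/\ is_rough_integral X XX Y Y' s t I,
      (`|I - leftlim Y s (incr X s t) - leftlim Y' s (XXtilde X XX s t)|%:E <=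
       C%:E *
       (variation_norm (p / 2) (remainder_tilde X Y Y') s t *
          variation_norm p (incr X) s t +
        variation_norm p (incr (leftlim Y')) s t *
          variation_norm (p / 2) (XXtilde X XX) s t))%E &
      (`|I - Y s (incr X s t) - Y' s (XX s t)|%:E <=
       C%:E *
       (variation_norm (p / 2) (remainder X Y Y') s t *
          variation_norm p (incr X) s t +
        variation_norm p (incr Y') s t *
          variation_norm (p / 2) XX s t))%E]).
Proof.
have p3_lt1 : 0 < p / 3 < 1 by have /andP[] := hp; lra.
have p0 : 0 < p by have /andP[] := hp; lra.
have p20 : 0 < p / 2 by rewrite divr_gt0.
have ww : (p / 3)^-1 = (p / 2)^-1 + p^-1 by field; rewrite gt_eqF.
have [C C0 estimate] := young_estimate p3_lt1.
exists C => T d E X XX Y Y' T0 rough controlled.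
have integral s t := exists_rough_integral hp rough controlled (s := s) (t := t).
split=> [|s t s0 st tT]; first exact: integral.
have [I int] := integral s t s0 st tT.
have sT : 0 <= s <= T by rewrite s0 (le_trans st).
have Xss : incr X s s = 0 by rewrite /incr subrr.
have XXss := XX_diag rough sT.
exists I; split=> //.
- rewrite -addrA -opprD.
  apply: (estimate _ _ _ _ _ (germ_left X XX Y Y') (remainder_tilde X Y Y')
    (incr X) (incr (leftlim Y')) (XXtilde X XX) _ _ s t I p20 p0 ww _ _ st int.1).
    move=> a b c sa ab bc ct; apply: (defect_germ_left_le Y Y' rough).
    + exact: le_trans sa.
    + exact: ltW.
    + exact: ltW.
    + exact: le_trans tT.
  by rewrite /germ_left /XXtilde Xss XXss tensor0r addr0 !linear0 addr0.
- rewrite -addrA -opprD.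
  apply: (estimate _ _ _ _ _ (germ X XX Y Y') (remainder X Y Y')
    (incr X) (incr Y') XX _ _ s t I p20 p0 ww _ _ st int.2).
    move=> a b c sa ab bc ct; apply: (defect_germ_le Y Y' rough).
    + exact: le_trans sa.
    + exact: ltW.
    + exact: ltW.
    + exact: le_trans tT.
  by rewrite /germ Xss XXss !linear0 addr0.
Qed.
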